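(* Let $\epsilon>0$ be fixed and let $p=p(n)$ satisfy $1\gg p\ge n^{-\frac14+\epsilon}$ as $n\to\infty$. Then, with high probability, uniformly over all $\mathbf u\in[0,1]^n$ with $\sum_{i\in[n]}u_i=\Omega(n)$, the following hold: (a) $\displaystyle\chi(\mathbf G_p^{\times})=(1+o(1))\frac{p}{2\log(pn)}\max_{U\subseteq[n]}\frac1{|U|}\Big(\sum_{i\in U}u_i\Big)^2$, where $\mathbf G_p^\times\sim\mathcal M^\times(\mathbf u,p)$; (b) $\displaystyle\chi(\mathbf G_p^{+})=(1+o(1))\frac{p}{\log(pn)}\sum_{i\in[n]}u_i$, where $\mathbf G_p^+\sim\mathcal M^+(\mathbf u,p)$.
   Context: For $\mathbf u=(u_1,\dots,u_n)^T\in[0,1]^n$ and $p\in[0,1]$, $\mathcal M^\times(\mathbf u,p)$ is the random graph on $[n]$ where each pair $ij$ is an edge independently with probability $p\,u_iu_j$ (Chung–Lu model). For $p\in[0,\tfrac12]$, $\mathcal M^+(\mathbf u,p)$ is the random graph on $[n]$ where each pair $ij$ is an edge independently with probability $p(u_i+u_j)$. $\chi$ is the chromatic number, $\log$ natural logarithm. $a\gg b$ means $b=o(a)$; $a=\Omega(b)$ means $b=O(a)$ with $a>0$. ''With high probability'' means with probability tending to $1$ as $n\to\infty$; $X=(1+o(1))Y$ whp means for every fixed $\delta>0$, $(1-\delta)Y\le X\le(1+\delta)Y$ with probability tending to $1$. *)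

(* Defs.v *)
From HB Require Import structures.
From mathcomp Require Import all_boot all_order all_algebra.
Set Implicit Arguments.
Unset Strict Implicit.
Unset Printing Implicit Defensive.
Import Order.TTheory GRing.Theory Num.Theory.

Definition colorable (T : finType) (e : rel T) (k : nat) : bool :=
  [exists f : {ffun T -> 'I_k}, [forall x, forall y, e x y ==> (f x != f y)]].

(* #|T| colours always suffice for an irreflexive e, so the search may stop
   there; the value is meaningless when e has a loop. *)
Definition chromatic_number (T : finType) (e : rel T) : nat :=
  [arg min_(k < (ord_max : 'I_#|T|.+1) | colorable e k) (k : nat)].

Lemma colorable_card (T : finType) (e : rel T) :
  irreflexive e -> colorable e #|T|.
Proof.
move=> eirr; apply/existsP; exists [ffun x => enum_rank x].
apply/forallP => x; apply/forallP => y; apply/implyP => exy; rewrite !ffunE.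
by apply: contraTneq exy => /enum_rank_inj ->; rewrite eirr.
Qed.

Lemma chromatic_numberP (T : finType) (e : rel T) : irreflexive e ->
  colorable e (chromatic_number e) /\
  (forall k, colorable e k -> (chromatic_number e <= k)%N).
Proof.
move=> /colorable_card ce; rewrite /chromatic_number.
case: arg_minnP => // i ci imin; split=> // k ck.
have [kT|Tk] := leqP k #|T|; first exact: (imin (Ordinal (kT : k < #|T|.+1)%N)).
by apply: leq_trans (ltnW Tk); rewrite -ltnS.
Qed.

(* A graph on {0, ..., n-1} is given by its edge set G \subset vpairs n, the
   unordered pair {i, j} being represented by (i, j) with i < j. *)

Definition vpairs (n : nat) : {set 'I_n * 'I_n} := [set e : 'I_n * 'I_n | (e.1 < e.2)%N].

Definition adj (n : nat) (G : {set 'I_n * 'I_n}) : rel 'I_n :=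
  fun i j => ((i, j) \in G) || ((j, i) \in G).

Lemma adj_irr (n : nat) (G : {set 'I_n * 'I_n}) :
  G \subset vpairs n -> irreflexive (adj G).
Proof.
move=> /subsetP sG i; rewrite /adj orbb; apply/negP => /sG.
by rewrite inE ltnn.
Qed.

Definition chi (n : nat) (G : {set 'I_n * 'I_n}) : nat :=
  chromatic_number (adj G).

Local Open Scope ring_scope.

(* Law of the random graph in which the pairs ij, i < j, are edges
   independently, each with probability q i j; a probability law only when the
   q i j lie in [0, 1], which for the two models below holds if all u i are in
   [0, 1] and p is in [0, 1] (product), resp. [0, 1/2] (sum). *)

Definition graph_mass (R : numDomainType) (n : nat) (q : 'I_n -> 'I_n -> R)
    (G : {set 'I_n * 'I_n}) : R :=
  \prod_(e in vpairs n) (if e \in G then q e.1 e.2 else 1 - q e.1 e.2).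

Definition graph_prob (R : numDomainType) (n : nat) (q : 'I_n -> 'I_n -> R)
    (A : pred {set 'I_n * 'I_n}) : R :=
  \sum_(G in powerset (vpairs n) | A G) graph_mass q G.

Lemma graph_prob_edges (R : numDomainType) (n : nat) (q : 'I_n -> 'I_n -> R)
    (S : {set 'I_n * 'I_n}) : S \subset vpairs n ->
  graph_prob q (fun G => S \subset G) = \prod_(e in S) q e.1 e.2.
Proof.
move=> sS; rewrite /graph_prob /graph_mass.
pose F e := if e \in vpairs n then q e.1 e.2 else 0.
pose H e := if e \in vpairs n then (if e \in S then 0 else 1 - q e.1 e.2) else 1.
transitivity (\prod_e (F e + H e)); last first.
  rewrite [RHS]big_mkcond; apply: eq_bigr => e _; rewrite /F /H.
  have [eS|eS] := boolP (e \in S); first by rewrite (subsetP sS) // addr0.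
  by case: ifP => _; rewrite ?add0r // addrC subrK.
rewrite bigA_distr [LHS]big_mkcond; apply: eq_bigr => G _; rewrite inE.
have [sG|/subsetPn[e eG eV]] /= := boolP (G \subset vpairs n); last first.
  by rewrite (bigD1 e) //= eG /F (negbTE eV) mul0r.
have [sSG|/subsetPn[e eS eG]] := boolP (S \subset G); last first.
  by rewrite (bigD1 e) //= (negbTE eG) /H (subsetP sS) // eS mul0r.
rewrite [LHS]big_mkcond; apply: eq_bigr => e _; rewrite /F /H.
have [eG|eG] := boolP (e \in G); first by rewrite (subsetP sG).
by rewrite (negbTE (contra (subsetP sSG e) eG)).
Qed.

Lemma graph_probT (R : numDomainType) (n : nat) (q : 'I_n -> 'I_n -> R) :
  graph_prob q xpredT = 1.
Proof.
rewrite -[RHS](big_set0 1 *%R (fun e => q e.1 e.2)) -graph_prob_edges ?sub0set//.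
by apply: eq_bigl => G; rewrite sub0set.
Qed.

Definition model_times (R : numDomainType) (n : nat) (u : 'I_n -> R) (p : R)
    (A : pred {set 'I_n * 'I_n}) : R :=
  graph_prob (fun i j => p * u i * u j) A.

Definition model_plus (R : numDomainType) (n : nat) (u : 'I_n -> R) (p : R)
    (A : pred {set 'I_n * 'I_n}) : R :=
  graph_prob (fun i j => p * (u i + u j)) A.

(* All terms are nonnegative, so the starting value 0 of the big operator does
   not affect the maximum. *)
Definition max_density (R : realFieldType) (n : nat) (u : 'I_n -> R)
    : R :=
  \big[Num.max/0]_(U : {set 'I_n} | (0 < #|U|)%N)
     (#|U|%:R^-1 * (\sum_(i in U) u i) ^+ 2).

(* Main.v *)
Require Import Defs.
From mathcomp Require Import all_boot all_order all_algebra.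
From mathcomp Require Import all_classical all_reals all_analysis.
From mathcomp Require Import ring lra.
(* The names of classical_sets shadow those of finset. *)
From mathcomp Require Import fintype finset.
Import Order.TTheory GRing.Theory Num.Theory.
Import numFieldNormedType.Exports.
Local Open Scope ring_scope.
Set Implicit Arguments.
Unset Strict Implicit.
Unset Printing Implicit Defensive.

(* Both models have edge probabilities p h(u_i, u_j) with h symmetric and
   monotone: the product or the sum.  Write L = ln (p n), Y for the predicted
   chromatic number and u(S) for the weight of a vertex set S.

   Lower bound.  By a first moment computation, with high probability no
   independent set S has more than ((1 + d) L - 1) |S| expected edges.  This
   means p u(S)^2 <= 2 (1 + d) L |S| in the product model and
   p u(S) <= (1 + d) L in the sum model.  Summing over the colour classes, with
   the Cauchy-Schwarz inequality in the product model, gives the bound.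

   Upper bound.  Order the vertices by weight and cut them into s = n / k
   consecutive blocks of k = (1 + d/2) Y vertices.  By Janson's inequality, with
   probability 1 - e^(-n) every vertex set meeting each block in at least
   M = k / L^2 vertices contains an independent transversal of the blocks: the
   overlap of two transversals is controlled because the energy of a set of
   blocks, measured by block maxima, is bounded by averages over the preceding
   blocks, hence by the definition of Y.  The overlaps of size two contribute
   (s / M)^2, which is o(1 / n) exactly because p >= n^(-1/4 + eps).  Removing
   k - M disjoint transversals leaves O(k + n / L^2) vertices, which span a
   sparse graph and need only o(Y) further colours. *)

(** * Elementary estimates *)

Lemma subr_sum_le_prod (R : numDomainType) (J : Type) (r : seq J) (P : pred J) (a : J -> R) :
  (forall j, P j -> 0 <= a j <= 1) ->
  1 - \sum_(j <- r | P j) a j <= \prod_(j <- r | P j) (1 - a j).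
Proof.
move=> a01; elim: r => [|j r IH]; first by rewrite !big_nil subr0.
rewrite !big_cons; case: ifP => // Pj; have /andP[a0 a1] := a01 j Pj.
apply: (@le_trans _ _ ((1 - a j) * (1 - \sum_(i <- r | P i) a i))); last first.
  by rewrite ler_wpM2l // subr_ge0.
have sum_ge0 : 0 <= \sum_(i <- r | P i) a i.
  by apply: sumr_ge0 => i /a01/andP[].
by rewrite mulrBr mulr1 mulrBl mul1r opprD addrA lerD2l opprB lerDr mulr_ge0.
Qed.

Lemma sqr_sum_le_card (R : realFieldType) (I : finType) (a : I -> R) :
  (\sum_i a i) ^+ 2 <= #|I|%:R * \sum_i a i ^+ 2.
Proof.
apply: (@le_trans _ _ (\sum_i \sum_j (a i ^+ 2 + a j ^+ 2) / 2)).
  rewrite expr2 mulr_suml; apply: ler_sum => i _; rewrite mulr_sumr; apply: ler_sum => j _.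
  by have := sqr_ge0 (a i - a j); rewrite !expr2; lra.
under eq_bigr => i _ do rewrite -mulr_suml big_split /= sumr_const.
rewrite -mulr_suml big_split /= sumr_const sumrMnl -mulr2n -[_ *+ 2]mulr_natr.
by rewrite mulfK ?pnatr_eq0 // mulr_natl.
Qed.

Lemma card_sum_fibers (T C : finType) (f : T -> C) (U : {set T}) :
  (#|U| = \sum_c #|[set i in U | f i == c]|)%N.
Proof.
rewrite -sum1_card (partition_big f xpredT) //; apply: eq_bigr => c _.
by rewrite -sum1_card; apply: eq_bigl => i; rewrite inE.
Qed.

Lemma sum_expr_card (R : comNzSemiRingType) (T : finType) (z : R) :
  \sum_(I : {set T}) z ^+ #|I| = (z + 1) ^+ #|T|.
Proof.
rewrite -[RHS](prodr_const (pred_of_simpl predT)) bigA_distr; apply: eq_bigr => I _.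
by rewrite -big_mkcond prodr_const.
Qed.

Lemma sum_large_expr_card_le (R : realType) (T : finType) (z b j : R) : 0 <= z -> 0 <= b ->
  \sum_(I : {set T} | j <= #|I|%:R) z ^+ #|I| <= expR (expR b * z * #|T|%:R - b * j).
Proof.
move=> z0 b0.
apply: (@le_trans _ _ (\sum_(I : {set T}) expR (- (b * j)) * (expR b * z) ^+ #|I|)).
  rewrite big_mkcond; apply: ler_sum => I _; case: ifP => [jI|_]; last first.
    by rewrite mulr_ge0 ?expR_ge0 // exprn_ge0 // mulr_ge0 ?expR_ge0.
  rewrite exprMn mulrA -[leLHS]mul1r ler_wpM2r ?exprn_ge0 //.
  by rewrite -expRM_natr -expRD -[leLHS]expR0 ler_expR addrC subr_ge0 ler_wpM2l.
rewrite -mulr_sumr sum_expr_card [in leRHS]addrC expRD ler_wpM2l ?expR_ge0 //.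
rewrite expRM_natr lerXn2r ?nnegrE ?addr_ge0 ?mulr_ge0 ?expR_ge0 //.
by rewrite addrC expR_ge1Dx.
Qed.

Lemma sqrr_1D_le (R : realFieldType) (a x : R) : 0 < a ->
  (1 + x) ^+ 2 <= 1 + a^-1 + (1 + a) * x ^+ 2.
Proof.
move=> a0; have : 0 <= a * (a^-1 - x) ^+ 2 by rewrite mulr_ge0 ?sqr_ge0 // ltW.
have -> : a * (a^-1 - x) ^+ 2 = a^-1 - 2 * x + a * x ^+ 2 by field; rewrite gt_eqF.
rewrite sqrrD expr1n mul1r; lra.
Qed.

Lemma expR1_le4 (R : realType) : expR 1 <= 4 :> R.
Proof.
have half_le : 2^-1 <= expR (- 2^-1) :> R by apply: le_trans (expR_ge1Dx _); lra.
have -> : expR 1 = (expR (- 2^-1) ^+ 2)^-1 :> R.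
  by rewrite -expRM_natr -expRN; congr expR; lra.
rewrite invf_ple ?posrE ?exprn_gt0 ?expR_gt0 //.
apply: (@le_trans _ _ (2^-1 ^+ 2)); first by lra.
by rewrite lerXn2r ?nnegrE ?expR_ge0.
Qed.

Lemma expR5_ge32 (R : realType) : 32 <= expR 5 :> R.
Proof.
have -> : expR 5 = expR 1 ^+ 5 :> R by rewrite -expRM_natr mul1r.
apply: (@le_trans _ _ (2 ^+ 5)); first by lra.
by rewrite lerXn2r ?nnegrE ?expR_ge0 //; have := expR_ge1Dx (1 : R); lra.
Qed.

Lemma expR_ln_half (R : realType) (x : R) : 0 < x -> expR (ln x / 2) = Num.sqrt x.
Proof. by move=> x0; rewrite -powR12_sqrt ?ltW // /powR gt_eqF // mulrC. Qed.

Lemma expR_opp_le_1B (R : realType) (d x y : R) :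
  0 <= d -> 0 <= x <= y -> (1 + d) * x <= d -> expR (- ((1 + d) * y)) <= 1 - x.
Proof.
move=> d0 /andP[x0 xy] xd.
apply: (@le_trans _ _ (expR (- ((1 + d) * x)))).
  by rewrite ler_expR lerN2 ler_wpM2l // addr_ge0.
rewrite expRN -div1r ler_pdivrMr ?expR_gt0 //.
have x1 : 0 <= 1 - x.
  by rewrite subr_ge0; case: (lerP x 1) => // x1; have := ler_wpM2l d0 (ltW x1); lra.
apply: le_trans (ler_wpM2l x1 (expR_ge1Dx _)).
have := ler_wpM2l x0 xd; lra.
Qed.

(** * Random subsets of a finite set *)

Section RandomSubset.
Variables (R : numDomainType) (T : finType).
Implicit Types (V D G : {set T}) (q : T -> R) (f g : {set T} -> R).

Definition subset_mass V q G : R :=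
  \prod_(e in V) (if e \in G then q e else 1 - q e).

Definition subset_mean V q f : R :=
  \sum_(G in powerset V) subset_mass V q G * f G.

Definition subset_prob V q (A : pred {set T}) : R :=
  subset_mean V q (fun G => (A G)%:R).

Definition absent D G : R := [disjoint D & G]%:R.

Definition absent_prob q D : R := \prod_(e in D) (1 - q e).

Lemma eq_subset_mean V q f g :
  (forall G, G \subset V -> f G = g G) -> subset_mean V q f = subset_mean V q g.
Proof. by move=> fg; apply: eq_bigr => G; rewrite inE => /fg ->. Qed.

Lemma subset_meanZ V q a f :
  subset_mean V q (fun G => a * f G) = a * subset_mean V q f.
Proof. by rewrite /subset_mean mulr_sumr; apply: eq_bigr => G _; rewrite mulrCA. Qed.

Lemma subset_mean_sum V q (J : Type) (r : seq J) (P : pred J) (f : J -> {set T} -> R) :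
  subset_mean V q (fun G => \sum_(j <- r | P j) f j G) =
  \sum_(j <- r | P j) subset_mean V q (f j).
Proof.
by rewrite /subset_mean exchange_big /=; apply: eq_bigr => G _; rewrite mulr_sumr.
Qed.

Lemma subset_meanB V q f g :
  subset_mean V q (fun G => f G - g G) = subset_mean V q f - subset_mean V q g.
Proof. by rewrite /subset_mean -sumrB; apply: eq_bigr => G _; rewrite mulrBr. Qed.

Lemma subset_mean_prod V q (a : T -> R) D : D \subset V ->
  subset_mean V q (fun G => \prod_(e in D :&: G) a e) =
  \prod_(e in D) (1 - q e + a e * q e).
Proof.
move=> sDV.
pose chosen e := if e \in V then (if e \in D then a e else 1) * q e else 0.
pose skipped e := if e \in V then 1 - q e else 1.
transitivity (\prod_e (chosen e + skipped e)); last first.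
  rewrite [RHS]big_mkcond; apply: eq_bigr => e _; rewrite /chosen /skipped.
  have [eD|eD] := boolP (e \in D); first by rewrite (subsetP sDV) // addrC.
  by case: ifP => _; rewrite ?add0r // mul1r addrC subrK.
rewrite bigA_distr /subset_mean [LHS]big_mkcond; apply: eq_bigr => G _; rewrite inE.
have [sGV|/subsetPn[e eG eV]] /= := boolP (G \subset V); last first.
  by rewrite (bigD1 e) //= eG /chosen (negbTE eV) mul0r.
rewrite /subset_mass [X in X * _]big_mkcond [X in _ * X]big_mkcond -big_split /=.
apply: eq_bigr => e _; rewrite /chosen /skipped in_setI.
have [eG|eG] := boolP (e \in G); last by rewrite andbF mulr1.
by rewrite (subsetP sGV) // andbT mulrC.
Qed.

Lemma subset_mean1 V q : subset_mean V q (fun=> 1) = 1.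
Proof.
have := subset_mean_prod q (fun=> 1) (sub0set V); rewrite big_set0 => {2}<-.
by apply: eq_subset_mean => G _; rewrite set0I big_set0.
Qed.

Lemma subset_massID V q D G : D \subset V ->
  subset_mass V q G = subset_mass D q (G :&: D) * subset_mass (V :\: D) q (G :\: D).
Proof.
move=> sDV; rewrite /subset_mass (big_setID D) /= (setIidPr sDV); congr (_ * _).
  by apply: eq_bigr => e eD; rewrite inE eD andbT.
by apply: eq_bigr => e; rewrite !inE => /andP[-> _].
Qed.

Lemma subset_mean_absentM_setD V q D f : D \subset V ->
  subset_mean V q (fun G => absent D G * f G) =
  absent_prob q D * subset_mean (V :\: D) q f.
Proof.
move=> sDV; rewrite /subset_mean mulr_sumr.
rewrite [LHS]big_mkcond [RHS]big_mkcond; apply: eq_bigr => G _; rewrite !inE /absent.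
have -> : (G \subset V :\: D) = (G \subset V) && [disjoint D & G].
  by rewrite subsetD disjoint_sym.
case: (G \subset V) => //=; have [dDG|_] /= := boolP [disjoint D & G]; last first.
  by rewrite mul0r mulr0.
rewrite mul1r mulrA (subset_massID q G sDV); congr (_ * _ * _).
  by apply: eq_bigr => e eD; rewrite inE (disjointFr dDG eD).
by have /setDidPl -> : [disjoint G & D] by rewrite disjoint_sym.
Qed.

Lemma subset_mean_setD V q D f : D \subset V ->
  subset_mean V q (fun G => f (G :\: D)) = subset_mean (V :\: D) q f.
Proof.
move=> sDV; rewrite /subset_mean.
rewrite (partition_big (fun G => G :\: D) (mem (powerset (V :\: D)))) /=; last first.
  by move=> G; rewrite !inE; exact: setSD.
apply: eq_bigr => B; rewrite inE => sB.
transitivity (\sum_(A in powerset D) subset_mass D q A * (subset_mass (V :\: D) q B * f B)).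
  rewrite (reindex_onto (fun A => A :|: B) (fun G => G :&: D)) /=.
    have dBD : B :&: D = set0.
      by apply/eqP; rewrite setI_eq0; move: sB; rewrite subsetD => /andP[].
    have BDE : B :\: D = B by apply/setDidPl; rewrite -setI_eq0 dBD.
    apply: eq_big => [A|A /andP[/andP[_ /eqP AB] /eqP AD]]; last first.
      by rewrite (subset_massID _ _ sDV) AB AD mulrA.
    rewrite !inE setDUl BDE setIUl dBD setU0.
    apply/idP/idP => [/andP[_ /eqP/setIidPl //]|sAD].
    rewrite (setIidPl sAD) eqxx andbT subUset (subset_trans sAD sDV).
    rewrite (subset_trans sB (subsetDl _ _)) /=.
    by move: sAD; rewrite -setD_eq0 => /eqP ->; rewrite set0U.
  by move=> G /andP[_ /eqP <-]; rewrite setID.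
rewrite -mulr_suml; have := subset_mean1 D q; rewrite /subset_mean.
by under eq_bigr do rewrite mulr1; move=> ->; rewrite mul1r.
Qed.

Lemma subset_mean_absentM V q D f : D \subset V ->
  subset_mean V q (fun G => absent D G * f G) =
  absent_prob q D * subset_mean V q (fun G => f (G :\: D)).
Proof. by move=> sDV; rewrite subset_mean_absentM_setD // subset_mean_setD. Qed.

Lemma subset_mean_absent V q D : D \subset V ->
  subset_mean V q (absent D) = absent_prob q D.
Proof.
move=> sDV; have := subset_mean_absentM q (fun=> 1) sDV; rewrite subset_mean1 mulr1 => <-.
by apply: eq_subset_mean => G _; rewrite mulr1.
Qed.

Lemma absent01 D G : 0 <= absent D G <= 1.
Proof. by rewrite /absent; case: [disjoint _ & _]; rewrite lexx ler01. Qed.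

Lemma absentU D D' G : absent (D :|: D') G = absent D G * absent D' G.
Proof. by rewrite /absent -natrM mulnb -!setI_eq0 setIUl setU_eq0. Qed.

Lemma absent_probUI q D D' :
  absent_prob q (D :|: D') * absent_prob q (D :&: D') = absent_prob q D * absent_prob q D'.
Proof.
rewrite /absent_prob [\prod_(e in D :|: D') _](big_setID D) [\prod_(e in D') _](big_setID D) /=.
have -> : (D :|: D') :&: D = D by apply/setIidPr; exact: subsetUl.
by rewrite setDUl setDv set0U setIC [X in _ = _ * X]mulrC mulrA.
Qed.

Section Probability.
Variables (V : {set T}) (q : T -> R).
Hypothesis q01 : forall e, 0 <= q e <= 1.

Lemma subset_mass_ge0 G : 0 <= subset_mass V q G.
Proof.
apply: prodr_ge0 => e _; have /andP[q0 q1] := q01 e.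
by case: ifP => // _; rewrite subr_ge0.
Qed.

Lemma absent_prob_ge0 D : 0 <= absent_prob q D.
Proof. by apply: prodr_ge0 => e _; rewrite subr_ge0; have /andP[] := q01 e. Qed.

Lemma ler_subset_mean f g :
  (forall G, G \subset V -> f G <= g G) -> subset_mean V q f <= subset_mean V q g.
Proof.
move=> fg; apply: ler_sum => G; rewrite inE => /fg.
exact/ler_wpM2l/subset_mass_ge0.
Qed.

Lemma subset_mean_ge0 f : (forall G, 0 <= f G) -> 0 <= subset_mean V q f.
Proof. by move=> f0; apply: sumr_ge0 => G _; rewrite mulr_ge0 ?subset_mass_ge0. Qed.

(* The case of Harris' inequality in which the decreasing event is the absence
   of a given set. *)
Lemma subset_mean_absentM_le D f : D \subset V ->
  (forall G, f (G :\: D) <= f G) ->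
  subset_mean V q (fun G => absent D G * f G) <= absent_prob q D * subset_mean V q f.
Proof.
move=> sDV fD; rewrite subset_mean_absentM // ler_wpM2l ?absent_prob_ge0 //.
exact: ler_subset_mean.
Qed.

Lemma ler_subset_prob (A B : pred {set T}) :
  (forall G, G \subset V -> A G -> B G) -> subset_prob V q A <= subset_prob V q B.
Proof.
move=> AB; apply: ler_subset_mean => G sGV.
by have := AB G sGV; case: (A G) => [-> //|_]; rewrite ler0n.
Qed.

Lemma subset_prob_exists_le (J : finType) (P : pred J) (A : J -> pred {set T}) :
  subset_prob V q (fun G => [exists j, P j && A j G]) <= \sum_(j | P j) subset_prob V q (A j).
Proof.
rewrite -subset_mean_sum; apply: ler_subset_mean => G _.
case: existsP => [[j /andP[Pj Aj]]|_]; last by apply: sumr_ge0 => j _; exact: ler0n.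
by rewrite (bigD1 j) //= Aj lerDl; apply: sumr_ge0 => l _; exact: ler0n.
Qed.

Lemma subset_prob_or_le (A B : pred {set T}) :
  subset_prob V q (fun G => A G || B G) <= subset_prob V q A + subset_prob V q B.
Proof.
rewrite /subset_prob /subset_mean -big_split /=; apply: ler_sum => G _.
rewrite -mulrDr ler_wpM2l ?subset_mass_ge0 // -natrD ler_nat.
by case: (A G); case: (B G).
Qed.

Lemma subset_prob_ge_compl (A B C : pred {set T}) (b c : R) :
  (forall G, G \subset V -> ~~ B G -> ~~ C G -> A G) ->
  subset_prob V q B <= b -> subset_prob V q C <= c -> 1 - (b + c) <= subset_prob V q A.
Proof.
move=> ABC Bb Cc; rewrite lerBlDr; apply: le_trans (lerD (lexx _) (lerD Bb Cc)).
apply: le_trans (lerD (lexx _) (subset_prob_or_le B C)).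
apply: le_trans (subset_prob_or_le A (fun G => B G || C G)).
rewrite -(subset_mean1 V q); apply: ler_subset_mean => G sGV.
rewrite ler1n lt0b; have := ABC G sGV.
by case: (A G) => //; case: (B G) => //; case: (C G) => //= /(_ isT isT).
Qed.

End Probability.
End RandomSubset.

Lemma graph_probE (R : numDomainType) (n : nat) (q : 'I_n -> 'I_n -> R)
    (A : pred {set 'I_n * 'I_n}) :
  graph_prob q A = subset_prob (vpairs n) (fun e => q e.1 e.2) A.
Proof.
rewrite /graph_prob /subset_prob /subset_mean big_mkcondr; apply: eq_bigr => G _.
by case: (A G); rewrite ?mulr1 ?mulr0.
Qed.

(** * Janson's inequality *)

Section Janson.
Variables (R : realType) (T J : finType) (V : {set T}) (q : T -> R).
Variables (D : J -> {set T}) (x : J -> R).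
Hypothesis q01 : forall e, 0 <= q e <= 1.
Hypothesis DV : forall j, D j \subset V.
Hypothesis x01 : forall j, 0 <= x j <= 1.

Definition dependent (i j : J) : bool := ~~ [disjoint D i & D j].

(* With all weights 1 this is the indicator that no D j is absent; smaller
   weights give an upper bound that remains to be optimised. *)
Definition avoidance (P : pred J) (r : seq J) (G : {set T}) : R :=
  \prod_(j <- r | P j) (1 - x j * absent R (D j) G).

Definition dependent_mass (i : J) (r : seq J) : R :=
  \sum_(j <- r | dependent i j) x i * x j * absent_prob q (D i :|: D j).

Lemma weighted_absent01 j G : 0 <= x j * absent R (D j) G <= 1.
Proof.
have /andP[x0 x1] := x01 j; have /andP[a0 a1] := absent01 R (D j) G.
by rewrite mulr_ge0 //= mulr_ile1.
Qed.

Lemma avoidance01 P r G : 0 <= avoidance P r G <= 1.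
Proof.
apply/andP; split.
  by apply: prodr_ge0 => j _; rewrite subr_ge0; have /andP[] := weighted_absent01 j G.
apply: prodr_ile1 => j _; have /andP[xa0 xa1] := weighted_absent01 j G.
by rewrite subr_ge0 xa1 gerBl.
Qed.

Lemma avoidance_ge0 P r G : 0 <= avoidance P r G.
Proof. by have /andP[] := avoidance01 P r G. Qed.

Lemma avoidance_setD_le P r (E G : {set T}) : avoidance P r (G :\: E) <= avoidance P r G.
Proof.
apply: ler_prod => j _; rewrite subr_ge0; have /andP[_ ->] /= := weighted_absent01 j (G :\: E).
rewrite lerB // ler_wpM2l //; first by have /andP[] := x01 j.
rewrite ler_nat; case: (boolP [disjoint D j & G]) => // dG.
by rewrite (disjointWr (subsetDl G E) dG).
Qed.

Lemma avoidance_setD_independent i r (G : {set T}) :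
  avoidance (fun j => ~~ dependent i j) r (G :\: D i) =
  avoidance (fun j => ~~ dependent i j) r G.
Proof.
apply: eq_bigr => j; rewrite negbK => dij; congr (_ - _ * _); congr (nat_of_bool _)%:R.
rewrite -!setI_eq0; congr (_ == _); apply/setP => e; rewrite !inE.
by case: (boolP (e \in D j)) => //= ej; rewrite (disjointFl dij ej).
Qed.

Lemma avoidance_ge_independent i r G :
  avoidance (fun j => ~~ dependent i j) r G *
    (1 - \sum_(j <- r | dependent i j) x j * absent R (D j) G) <= avoidance xpredT r G.
Proof.
rewrite [leRHS](bigID (dependent i)) /= mulrC ler_wpM2r ?avoidance_ge0 //.
by apply: subr_sum_le_prod => j _; exact: weighted_absent01.
Qed.

(* Only the events sharing an element with event i need the linear bound: for
   the others, deleting D i does not change the product. *)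
Lemma mean_absentM_avoidance_ge i r :
  subset_mean V q (avoidance (fun j => ~~ dependent i j) r) *
    (absent_prob q (D i) - \sum_(j <- r | dependent i j) x j * absent_prob q (D i :|: D j))
  <= subset_mean V q (fun G => absent R (D i) G * avoidance xpredT r G).
Proof.
set C := avoidance _ r.
apply: (@le_trans _ _ (subset_mean V q (fun G => absent R (D i) G *
    (C G * (1 - \sum_(j <- r | dependent i j) x j * absent R (D j) G))))); last first.
  by apply: ler_subset_mean => // G _; rewrite ler_wpM2l ?avoidance_ge_independent.
rewrite [leRHS](eq_subset_mean q (g := fun G => absent R (D i) G * C G -
    \sum_(j <- r | dependent i j) x j * (absent R (D i :|: D j) G * C G))) => [|G _]; last first.
  rewrite mulrBr mulr1 mulrBr; congr (_ - _); rewrite !mulr_sumr.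
  by apply: eq_bigr => j _; rewrite absentU; ring.
rewrite subset_meanB subset_mean_sum mulrBr; apply: lerB.
  rewrite subset_mean_absentM // mulrC.
  rewrite (eq_subset_mean q (f := fun G => C (G :\: D i)) (g := C)) // => G _.
  exact: avoidance_setD_independent.
rewrite mulr_sumr; apply: ler_sum => j _; rewrite subset_meanZ mulrCA.
rewrite ler_wpM2l //; first by have /andP[] := x01 j.
rewrite [leRHS]mulrC subset_mean_absentM_le ?subUset ?DV // => G.
exact: avoidance_setD_le.
Qed.

Lemma mean_avoidance_cons i r :
  subset_mean V q (avoidance xpredT (i :: r)) <=
  subset_mean V q (avoidance xpredT r) *
    expR (dependent_mass i r - x i * absent_prob q (D i)).
Proof.
set Z := subset_mean V q (avoidance xpredT r).
have Z0 : 0 <= Z by apply: subset_mean_ge0 => // G; exact: avoidance_ge0.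
have /andP[xi0 xi1] := x01 i.
set a := x i * _; have [a_le|a_gt] := leP a (dependent_mass i r).
  apply: (@le_trans _ _ Z).
    apply: ler_subset_mean => // G _; rewrite {1}/avoidance big_cons.
    rewrite -[leRHS]mul1r ler_wpM2r ?avoidance_ge0 // gerBl.
    by have /andP[] := weighted_absent01 i G.
  by rewrite -[leLHS]mulr1 ler_wpM2l // -expR0 ler_expR subr_ge0.
apply: le_trans (ler_wpM2l Z0 (expR_ge1Dx _)); rewrite mulrDr mulr1.
rewrite [leLHS](eq_subset_mean q (g := fun G => avoidance xpredT r G -
    x i * (absent R (D i) G * avoidance xpredT r G))) => [|G _]; last first.
  by rewrite {1}/avoidance big_cons mulrBl mul1r mulrA.
rewrite subset_meanB subset_meanZ lerD2l -opprB mulrN lerN2.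
apply: le_trans (ler_wpM2l xi0 (mean_absentM_avoidance_ge i r)).
rewrite [leRHS]mulrCA.
have <- : a - dependent_mass i r =
    x i * (absent_prob q (D i) - \sum_(j <- r | dependent i j) x j * absent_prob q (D i :|: D j)).
  by rewrite mulrBr mulr_sumr; congr (_ - _); apply: eq_bigr => j _; rewrite mulrA.
apply: ler_wpM2r; first by rewrite subr_ge0 ltW.
apply: ler_subset_mean => // G _.
rewrite [leLHS](bigID (dependent i)) /= -[leRHS]mul1r ler_wpM2r ?avoidance_ge0 //.
by have /andP[] := avoidance01 (dependent i) r G.
Qed.

Lemma mean_avoidance_le r :
  subset_mean V q (avoidance xpredT r) <=
  expR (\sum_(i <- r) dependent_mass i r - \sum_(j <- r) x j * absent_prob q (D j)).
Proof.
have summand_ge0 i j : 0 <= x i * x j * absent_prob q (D i :|: D j).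
  by rewrite !mulr_ge0 ?absent_prob_ge0 //; [have /andP[] := x01 i|have /andP[] := x01 j].
have dependent_mass_cons i j s : dependent_mass i s <= dependent_mass i (j :: s).
  by rewrite /dependent_mass big_cons; case: ifP => // _; rewrite lerDr.
elim: r => [|i r IH].
  rewrite !big_nil subr0 expR0 -(subset_mean1 V q).
  by apply: ler_subset_mean => // G _; have /andP[] := avoidance01 xpredT [::] G.
apply: le_trans (mean_avoidance_cons i r) _.
apply: (le_trans (ler_wpM2r (expR_ge0 _) IH)).
rewrite -expRD ler_expR !big_cons opprD [leLHS]addrC addrACA lerD2r.
by rewrite lerD // ler_sum.
Qed.

Lemma janson :
  subset_prob V q (fun G => [forall j, (x j != 0) ==> ~~ [disjoint D j & G]]) <=
  expR (\sum_i \sum_(j | dependent i j) x i * x j * absent_prob q (D i :|: D j)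
        - \sum_j x j * absent_prob q (D j)).
Proof.
apply: le_trans (mean_avoidance_le (index_enum J)).
apply: ler_subset_mean => // G _.
case: (boolP [forall j, _]) => [/forallP none_absent|_]; last exact: avoidance_ge0.
rewrite /avoidance big1 // => j _; have := none_absent j; rewrite /absent.
by case: (eqVneq (x j) 0) => [->|_ /negbTE ->]; rewrite ?mul0r ?mulr0 subr0.
Qed.

End Janson.

(* Taking the weight of an event inversely proportional to its probability
   turns Janson's inequality into a second moment bound. *)
Lemma janson_second_moment (R : realType) (T J : finType) (V : {set T}) (q : T -> R)
    (D : J -> {set T}) (F : {set J}) (rho : R) :
  (forall e, 0 <= q e <= 1) -> (forall j, D j \subset V) -> (0 < #|F|)%N -> 0 < rho ->
  (forall j, j \in F -> (2 * rho * #|F|%:R)^-1 <= absent_prob q (D j)) ->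
  \sum_(i in F) \sum_(j in F | dependent D i j)
     absent_prob q (D i :|: D j) / (absent_prob q (D i) * absent_prob q (D j))
    <= rho * #|F|%:R ^+ 2 ->
  subset_prob V q (fun G => [forall j in F, ~~ [disjoint D j & G]]) <= expR (- (4 * rho)^-1).
Proof.
move=> q01 DV F0 rho0 lamP pairs.
have N0 : 0 < #|F|%:R :> R by rewrite ltr0n.
set lam := (2 * rho * #|F|%:R)^-1 in lamP.
have lam0 : 0 < lam by rewrite invr_gt0 !mulr_gt0.
have P0 j : j \in F -> 0 < absent_prob q (D j).
  by move=> /lamP; exact: lt_le_trans.
pose x j := if j \in F then lam / absent_prob q (D j) else 0.
have x01 j : 0 <= x j <= 1.
  rewrite /x; case: ifP => [jF|_]; last by rewrite lexx ler01.
  by rewrite divr_ge0 ?(ltW lam0) ?(ltW (P0 _ jF)) //= ler_pdivrMr ?P0 // mul1r lamP.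
apply: (le_trans _ (le_trans (janson q01 DV x01) _)).
  apply: ler_subset_prob => // G _ /forall_inP none_absent; apply/forallP => j.
  by rewrite /x; case: ifP => [/none_absent ->|_]; rewrite ?implybT ?eqxx.
have -> : \sum_j x j * absent_prob q (D j) = (2 * rho)^-1.
  rewrite (bigID (mem F)) /= [X in _ + X]big1 ?addr0 => [|j /negbTE jF]; last first.
    by rewrite /x jF mul0r.
  rewrite (eq_bigr (fun=> lam)) => [|j jF]; last by rewrite /x jF divfK // gt_eqF ?P0.
  by rewrite sumr_const -mulr_natr /lam; field; rewrite !gt_eqF.
have weighted_pairs : \sum_i \sum_(j | dependent D i j) x i * x j * absent_prob q (D i :|: D j) =
    lam ^+ 2 * \sum_(i in F) \sum_(j in F | dependent D i j)
       absent_prob q (D i :|: D j) / (absent_prob q (D i) * absent_prob q (D j)).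
  rewrite mulr_sumr [RHS]big_mkcond; apply: eq_bigr => i _; rewrite /x.
  case: ifP => iF; last by rewrite big1 // => j _; rewrite !mul0r.
  rewrite mulr_sumr [RHS]big_mkcondl [LHS]big_mkcond [RHS]big_mkcond; apply: eq_bigr => j _.
  case: ifP => // _; case: ifP => jF; last by rewrite mulr0 mul0r.
  by rewrite invfM expr2; ring.
rewrite ler_expR weighted_pairs lerBlDr.
apply: le_trans (ler_wpM2l (exprn_ge0 2 (ltW lam0)) pairs) _.
rewrite (_ : lam ^+ 2 * _ = - (4 * rho)^-1 + (2 * rho)^-1) //.
by rewrite /lam; field; rewrite !gt_eqF.
Qed.

(** * Independent sets and colourings *)

Section Graph.
Variable n : nat.
Implicit Types (G : {set 'I_n * 'I_n}) (S X Y : {set 'I_n}) (i j : 'I_n).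

Definition pairs_within S : {set 'I_n * 'I_n} :=
  [set e in vpairs n | (e.1 \in S) && (e.2 \in S)].

Definition independent G S : bool := [disjoint pairs_within S & G].

Definition colorable_on G X (k : nat) : Prop :=
  exists2 c : 'I_n -> nat, {in X, forall x, c x < k}%N &
    {in X &, forall x y, adj G x y -> c x <> c y}.

Definition degree_in G X i : nat := #|[set j in X | adj G i j]|.

Definition min_degree_ge (d : nat) G X : bool := [forall i in X, (d <= degree_in G X i)%N].

Lemma pairs_within_sub S : pairs_within S \subset vpairs n.
Proof. by apply/subsetP => e; rewrite inE => /andP[]. Qed.

Lemma pairs_withinI S X : pairs_within S :&: pairs_within X = pairs_within (S :&: X).
Proof.
apply/setP => e; rewrite !inE; case: (_ < _)%N => //=.
by case: (e.1 \in S); case: (e.2 \in S); case: (e.1 \in X); case: (e.2 \in X).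
Qed.

Lemma sum_pairs_within (V : nmodType) (F : 'I_n -> 'I_n -> V) S : (forall i j, F i j = F j i) ->
  (\sum_(e in pairs_within S) F e.1 e.2) *+ 2 = \sum_(i in S) \sum_(j in S | j != i) F i j.
Proof.
move=> symF; rewrite pair_big_dep [RHS](bigID (fun e : 'I_n * 'I_n => (e.1 < e.2)%N)) /=.
rewrite mulr2n; congr (_ + _).
  apply: eq_bigl => e; rewrite !inE andbC.
  case: (ltnP e.1 e.2) => [lt_pair|]; last by rewrite !andbF.
  by rewrite !andbT neq_ltn lt_pair orbT andbT.
rewrite (reindex_inj (h := fun e : 'I_n * 'I_n => (e.2, e.1))) /=; last first.
  by move=> [a b] [c d] /= [-> ->].
apply: eq_big => [e|e _]; last exact: symF.
rewrite !inE -leqNgt; case: (ltnP e.2 e.1) => [lt_pair|le_pair] /=.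
  by rewrite neq_ltn lt_pair (ltnW lt_pair) andbT /= andbT andbC.
case: eqP => //=; rewrite ?andbF // => /eqP ne_pair.
by rewrite leqNgt ltn_neqAle le_pair eq_sym ne_pair /= andbF.
Qed.

Lemma adj_sym G i j : adj G i j = adj G j i.
Proof. by rewrite /adj orbC. Qed.

Lemma adj_edge G i j : G \subset vpairs n -> (i < j)%N -> adj G i j = ((i, j) \in G).
Proof.
move=> sG ij; rewrite /adj; case: (boolP ((j, i) \in G)) => [/(subsetP sG)|_]; last exact: orbF.
by rewrite inE /= ltnNge (ltnW ij).
Qed.

Lemma independentP G S : G \subset vpairs n ->
  reflect {in S &, forall i j, ~~ adj G i j} (independent G S).
Proof.
move=> sG; apply: (iffP idP) => [dG i j iS jS|indep].
  by apply/negP; case/orP=> eG; have := disjointFl dG eG; rewrite inE (subsetP sG) //= iS jS.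
rewrite /independent disjoint_subset; apply/subsetP => -[i j].
by rewrite !inE /= => /and3P[_ iS jS]; have := indep i j iS jS; rewrite negb_or => /andP[].
Qed.

Lemma colorable_on0 G k : colorable_on G set0 k.
Proof. by exists (fun=> 0%N) => x; rewrite ?inE // => y; rewrite inE. Qed.

Lemma colorable_on_independent G S :
  G \subset vpairs n -> independent G S -> colorable_on G S 1.
Proof.
move=> sG /(independentP _ sG) indep; exists (fun=> 0%N) => // x y xS yS xy.
by have := indep x y xS yS; rewrite xy.
Qed.

Lemma colorable_onS G X Y k l :
  (l <= k)%N -> X \subset Y -> colorable_on G Y l -> colorable_on G X k.
Proof.
move=> lk /subsetP XY [c cl cG]; exists c.
  by move=> x /XY xY; apply: leq_trans lk; exact: cl.
by move=> x y /XY xY /XY yY; exact: cG.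
Qed.

Lemma colorable_onU G X Y k l :
  colorable_on G X k -> colorable_on G Y l -> colorable_on G (X :|: Y) (k + l).
Proof.
move=> [c ck cG] [d dl dG].
exists (fun x => if x \in X then c x else (k + d x)%N).
  move=> x; rewrite inE; case: ifP => [xX _|_ /= xY]; last by rewrite ltn_add2l dl.
  by apply: leq_trans (ck x xX) _; exact: leq_addr.
move=> x y; rewrite !inE; case: ifP => [xX _|_ /= xY]; case: ifP => [yX _|_ /= yY] xy.
- exact: cG.
- by move=> same_color; have := ck x xX; rewrite same_color ltnNge leq_addr.
- by move=> same_color; have := ck y yX; rewrite -same_color ltnNge leq_addr.
- by move/addnI; apply: dG.
Qed.

Lemma chi_le_colorable_on G k :
  G \subset vpairs n -> colorable_on G [set: 'I_n] k -> (chi G <= k)%N.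
Proof.
move=> sG [c ck cG]; have [_ ] := chromatic_numberP (adj_irr sG); apply.
have ltck x : (c x < k)%N by apply: ck; rewrite inE.
apply/existsP; exists [ffun x => Ordinal (ltck x)].
apply/forallP => x; apply/forallP => y; apply/implyP => xy; rewrite !ffunE.
by apply/eqP => /(congr1 val) /=; apply: cG; rewrite ?inE.
Qed.

Lemma chi_color_classes G : G \subset vpairs n ->
  exists f : 'I_n -> 'I_(chi G), forall X (c : 'I_(chi G)), independent G [set i in X | f i == c].
Proof.
move=> sG; have [/existsP[f /forallP properf] _] := chromatic_numberP (adj_irr sG).
exists f => X c; apply/(independentP _ sG) => i j.
rewrite !inE => /andP[_ /eqP fi] /andP[_ /eqP fj].
apply: contraTN (forallP (properf i) j) => ij; rewrite ij /= negbK.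
by apply/eqP; rewrite fi fj.
Qed.

Lemma exists_fresh_color (T : finType) (N : {set T}) (c : T -> nat) (d : nat) :
  (#|N| < d)%N -> exists2 a, (a < d)%N & {in N, forall y, c y <> a}.
Proof.
move=> Nd; have /allPn[a] : ~~ all (mem [seq c y | y in N]) (iota 0 d).
  apply: contraL Nd => /allP all_used; rewrite -leqNgt -(size_iota 0 d) -(size_image c N).
  exact: uniq_leq_size (iota_uniq 0 d) all_used.
rewrite mem_iota add0n => /andP[_ ad] /negP aN; exists a => // y yN cy; apply: aN.
by rewrite /= -cy image_f.
Qed.

Lemma colorable_on_degenerate G X (d : nat) : G \subset vpairs n ->
  (forall Y, Y \subset X -> Y != set0 -> ~~ min_degree_ge d G Y) -> colorable_on G X d.
Proof.
move=> sG; have [m] := ubnP #|X|; elim: m => // m IH in X *; rewrite ltnS => Xm degen.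
have [->|Xn0] := eqVneq X set0; first exact: colorable_on0.
have /forall_inPn[x xX] : ~~ min_degree_ge d G X by exact: degen.
rewrite -ltnNge => degx.
have [||c cd cG] := IH (X :\ x).
- by apply: leq_trans Xm; rewrite [X in (_ < X)%N](cardsD1 x) xX.
- by move=> Y sY; apply: degen; exact: subset_trans sY (subD1set _ _).
have [a ad aN] := exists_fresh_color c degx.
exists (fun y => if y == x then a else c y).
  by move=> y yX; case: eqP => // /eqP yx; apply: cd; rewrite !inE yx.
move=> y z yX zX; case: eqP => [->|/eqP yx]; case: eqP => [->|/eqP zx] yz.
- by rewrite (adj_irr sG) in yz.
- by move/esym; apply: aN; rewrite inE zX.
- by apply: aN; rewrite inE yX adj_sym.
- by apply: cG; rewrite // !inE ?yx ?zx.
Qed.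

Lemma sum_degree_in G X : G \subset vpairs n ->
  (\sum_(i in X) degree_in G X i = #|pairs_within X :&: G| * 2)%N.
Proof.
move=> sG; have := sum_pairs_within (F := fun i j => adj G i j : nat) X
  (fun i j => congr1 nat_of_bool (adj_sym G i j)).
have -> : \sum_(e in pairs_within X) (adj G e.1 e.2 : nat) = #|pairs_within X :&: G|.
  rewrite -sum1_card [RHS](eq_bigl _ _ (fun e => in_setI _ _ _)) [RHS]big_mkcondr.
  apply: eq_bigr => -[i j]; rewrite inE /= => /andP[]; rewrite inE /= => ij _.
  by rewrite adj_edge //; case: ((i, j) \in G).
rewrite mulr2n muln2 -addnn => pairs; apply/esym/(etrans pairs).
apply: eq_bigr => i iX; rewrite /degree_in -sum1_card.
rewrite big_mkcondr [LHS]big_mkcond [RHS]big_mkcond; apply: eq_bigr => j _; rewrite inE.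
case: (j \in X) => //=; case: eqP => [->|_]; first by rewrite (adj_irr sG).
by case: (adj G i j).
Qed.

End Graph.

Lemma sum_pairs_within_diag (V : zmodType) (n : nat) (F : 'I_n -> 'I_n -> V) (S : {set 'I_n}) :
  (forall i j, F i j = F j i) ->
  (\sum_(e in pairs_within S) F e.1 e.2) *+ 2 =
  \sum_(i in S) \sum_(j in S) F i j - \sum_(i in S) F i i.
Proof.
move=> symF; rewrite sum_pairs_within // -sumrB; apply: eq_bigr => i iS.
by rewrite [in RHS](bigD1 i) //= [RHS]addrC addKr.
Qed.

Section SparseGraph.
Variables (R : realType) (n : nat) (q : 'I_n * 'I_n -> R) (a : R).
Hypothesis q01 : forall e, 0 <= q e <= 1.
Hypothesis q_le : forall e, q e <= a.
Hypothesis a_ge0 : 0 <= a.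

Lemma sum_pairs_within_le (X : {set 'I_n}) :
  \sum_(e in pairs_within X) q e <= a * #|X|%:R ^+ 2 / 2.
Proof.
apply: (@le_trans _ _ (\sum_(e in pairs_within X) a)); first by apply: ler_sum.
have := sum_pairs_within_diag (F := fun _ _ => a) X (fun _ _ => erefl).
rewrite !sumr_const -!mulrnA -![a *+ _]mulr_natr !natrM expr2 => pairs.
have : 0 <= a * #|X|%:R by rewrite mulr_ge0.
lra.
Qed.

(* Markov's inequality for the exponential of the number of edges. *)
Lemma prob_min_degree_ge_le (X : {set 'I_n}) (d : nat) :
  subset_prob (vpairs n) q (fun G => min_degree_ge d G X) <=
  expR ((3 * a * #|X|%:R - d%:R) * #|X|%:R / 2).
Proof.
pose t : R := #|X|%:R * d%:R / 2.
apply: (@le_trans _ _ (subset_mean (vpairs n) q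
    (fun G => expR (- t) * \prod_(e in pairs_within X :&: G) expR 1))).
  apply: ler_subset_mean => // G sG; rewrite prodr_const -expRM_natr mul1r -expRD.
  case: (boolP (min_degree_ge d G X)) => [/forall_inP degX|_]; last exact: expR_ge0.
  rewrite -[leLHS]expR0 ler_expR addrC subr_ge0 ler_pdivrMr // -natrM -[2]/(2%:R) -natrM.
  by rewrite ler_nat -sum_degree_in // -sum_nat_const leq_sum.
rewrite subset_meanZ subset_mean_prod ?pairs_within_sub //.
apply: (@le_trans _ _ (expR (- t) * \prod_(e in pairs_within X) expR (3 * q e))).
  rewrite ler_wpM2l ?expR_ge0 //; apply: ler_prod => e _; have /andP[q0 q1] := q01 e.
  rewrite addr_ge0 ?subr_ge0 ?mulr_ge0 ?expR_ge0 //=; apply: le_trans (expR_ge1Dx _).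
  have := ler_wpM2r q0 (expR1_le4 R); lra.
rewrite -expR_sum -expRD ler_expR -mulr_sumr /t.
have := sum_pairs_within_le X; lra.
Qed.

Lemma prob_exists_min_degree_ge_le (m d : nat) :
  4 * a * m%:R <= d%:R -> n%:R * expR (- (a * m%:R / 4)) <= 1 ->
  subset_prob (vpairs n) q
    (fun G => [exists X : {set 'I_n}, (1 <= #|X| <= m)%N && min_degree_ge d G X])
  <= expR (1 - a * m%:R / 4).
Proof.
move=> amd nam; apply: le_trans (subset_prob_exists_le _ q01 _ _) _.
set z := expR (- (a * m%:R / 2)).
have am0 : 0 <= a * m%:R / 4 by rewrite divr_ge0 // mulr_ge0.
apply: (@le_trans _ _ (\sum_(X : {set 'I_n} | 1 <= #|X|%:R :> R) z ^+ #|X|)); last first.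
  apply: le_trans (sum_large_expr_card_le _ 1 (expR_ge0 _) am0) _.
  rewrite ler_expR mulr1 lerD2r card_ord -expRD mulrC; apply: le_trans nam.
  by rewrite ler_wpM2l // ler_expR; lra.
rewrite [leLHS]big_mkcond [leRHS]big_mkcond; apply: ler_sum => X _.
rewrite (ler_nat R 1); case: ifP => [/andP[-> Xm]|_]; last first.
  by case: ifP => // _; rewrite exprn_ge0 ?expR_ge0.
apply: le_trans (prob_min_degree_ge_le X d) _; rewrite -expRM_natr ler_expR.
have Xm_le : a * #|X|%:R <= a * m%:R by rewrite ler_wpM2l // ler_nat.
rewrite mulrAC ler_wpM2r //; lra.
Qed.

End SparseGraph.

(** * Independent transversals *)

Section Transversal.
Variables (n s : nat) (blk : 'I_n -> nat).
Implicit Types (V : {set 'I_n}) (f g : {ffun 'I_s -> 'I_n}) (I : {set 'I_s}).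

Definition block V (t : nat) : {set 'I_n} := [set i in V | blk i == t].

Definition transversals V : {set {ffun 'I_s -> 'I_n}} :=
  setXn (fun t : 'I_s => block V t).

Definition transversal_pairs f : {set 'I_n * 'I_n} := pairs_within (f @: [set: 'I_s]).

Definition agreement f g : {set 'I_s} := [set t | f t == g t].

Definition lacks_independent_transversal (M : nat) (G : {set 'I_n * 'I_n}) : bool :=
  [exists V, [forall t : 'I_s, (M <= #|block V t|)%N] &&
    [forall f in transversals V, ~~ independent G (f @: [set: 'I_s])]].

Lemma transversal_sub V f t : f \in transversals V -> f t \in V.
Proof. by move/setXnP/(_ t); rewrite inE => /andP[]. Qed.

Lemma transversal_blk V f t : f \in transversals V -> blk (f t) = t.
Proof. by move/setXnP/(_ t); rewrite inE => /andP[_ /eqP]. Qed.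

Lemma transversal_inj V f : f \in transversals V -> injective f.
Proof.
by move=> fV a b /(congr1 blk); rewrite !(transversal_blk _ fV) => /val_inj.
Qed.

Lemma imset_transversalI V f g : f \in transversals V -> g \in transversals V ->
  f @: [set: 'I_s] :&: g @: [set: 'I_s] = f @: agreement f g.
Proof.
move=> fV gV; apply/setP => v; rewrite inE.
apply/andP/imsetP => [[/imsetP[t _ ->] /imsetP[t' _ fg]]|[t]].
  have tt' : t = t'.
    by apply: val_inj; rewrite /= -(transversal_blk t fV) fg (transversal_blk t' gV).
  by exists t => //; rewrite inE fg tt'.
by rewrite inE => /eqP fg ->; rewrite {2}fg !imset_f.
Qed.

Lemma transversal_pairsI V f g : f \in transversals V -> g \in transversals V ->
  transversal_pairs f :&: transversal_pairs g = pairs_within (f @: agreement f g).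
Proof. by move=> fV gV; rewrite pairs_withinI (imset_transversalI fV gV). Qed.

Lemma dependent_transversals V f g : f \in transversals V -> g \in transversals V ->
  dependent transversal_pairs f g -> (1 < #|agreement f g|)%N.
Proof.
move=> fV gV; rewrite /dependent -setI_eq0 (transversal_pairsI fV gV).
case/set0Pn=> e; rewrite !inE => /and3P[e12 e1 e2].
rewrite -(card_imset _ (transversal_inj fV)); apply/card_gt1P; exists e.1, e.2; split=> //.
by rewrite neq_ltn e12.
Qed.

Lemma card_transversals V : #|transversals V| = (\prod_(t < s) #|block V t|)%N.
Proof. exact: cardsXn. Qed.

Lemma card_transversals_ge V M : (forall t : 'I_s, (M <= #|block V t|)%N) ->
  (M ^ s <= #|transversals V|)%N.
Proof.
move=> MV; rewrite card_transversals -[s in (_ ^ s)%N]card_ord -prod_nat_const.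
exact: leq_prod.
Qed.

Lemma card_transversals_agreeing V M f I :
  f \in transversals V -> (forall t : 'I_s, (M <= #|block V t|)%N) ->
  (#|[set g in transversals V | I \subset agreement f g]| * M ^ #|I| <= #|transversals V|)%N.
Proof.
move=> fV MV; pose Q (t : 'I_s) := if t \in I then [set f t] else block V t.
have -> : [set g in transversals V | I \subset agreement f g] = setXn Q.
  apply/setP => g; rewrite inE; apply/andP/setXnP => [[/setXnP gV /subsetP sI] t|gQ].
    by rewrite /Q; case: ifP => [/sI|_]; [rewrite !inE eq_sym|exact: gV].
  split; last by apply/subsetP => t tI; have := gQ t; rewrite /Q tI !inE eq_sym.
  apply/setXnP => t; have := gQ t; rewrite /Q; case: ifP => // _; rewrite inE => /eqP ->.
  exact: (setXnP fV).
rewrite cardsXn card_transversals -prod_nat_const [X in (_ * X)%N]big_mkcond.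
rewrite -big_split; apply: leq_prod => t _; rewrite /Q /=; case: ifP => _; last by rewrite muln1.
by rewrite cards1 mul1n.
Qed.

(* Remove independent transversals one at a time. *)
Lemma exists_colorable_on_transversals (M : nat) (G : {set 'I_n * 'I_n}) :
  G \subset vpairs n -> ~~ lacks_independent_transversal M G ->
  forall j V, (forall t : 'I_s, M + j <= #|block V t|)%N ->
  exists Y : {set 'I_n}, [/\ Y \subset V, colorable_on G Y j & #|Y| = (s * j)%N].
Proof.
move=> sG; rewrite negb_exists => /forallP rich.
elim=> [|j IH] V large.
  by exists set0; rewrite sub0set cards0 muln0; split=> //; exact: colorable_on0.
have /forall_inPn[f fV] : ~~ [forall f in transversals V, ~~ independent G (f @: [set: 'I_s])].
  apply: contra (rich V) => ->; rewrite andbT; apply/forallP => t.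
  by apply: leq_trans (large t); exact: leq_addr.
rewrite negbK; set S := f @: _ => indepS.
have [|Y [sY cY Yj]] := IH (V :\: S).
  move=> t; suff -> : block (V :\: S) t = block V t :\ f t.
    have ftV : f t \in block V t by rewrite inE (transversal_sub t fV) (transversal_blk t fV) /=.
    by have := large t; rewrite (cardsD1 (f t) (block V t)) ftV addnS add1n ltnS.
  apply/setP => i; rewrite !inE; case: (eqVneq i (f t)) => [->|ift] /=.
    by rewrite imset_f // inE.
  case: (boolP (i \in S)) => //= /imsetP[t' _ ift']; rewrite ift' (transversal_blk t' fV).
  by apply/esym/negbTE/nandP; right; apply: contraNneq ift => /val_inj <-; rewrite ift'.
exists (Y :|: S); split.
- rewrite subUset (subset_trans sY (subsetDl _ _)) /=.
  by apply/subsetP => _ /imsetP[t _ ->]; exact: transversal_sub fV.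
- by rewrite -addn1; apply: colorable_onU => //; exact: colorable_on_independent.
- have /eqP YS : Y :&: S == set0.
    by rewrite setI_eq0; move: sY; rewrite subsetD => /andP[].
  rewrite cardsU YS cards0 subn0 Yj card_imset ?cardsT ?card_ord ?mulnS 1?addnC //.
  exact: transversal_inj fV.
Qed.

End Transversal.

Definition pair_energy (R : unitRingType) (s : nat) (phi : nat -> nat -> R) (I : {set 'I_s}) : R :=
  (\sum_(t in I) \sum_(t' in I | t' != t) phi t t') / 2.

Definition overlap_sum (R : realType) (s M : nat) (phi : nat -> nat -> R) : R :=
  \sum_(I : {set 'I_s} | (1 < #|I|)%N) expR (pair_energy phi I) * M%:R^-1 ^+ #|I|.

Section TransversalProbability.
Variables (R : realType) (n s M : nat) (q : 'I_n * 'I_n -> R) (blk : 'I_n -> nat).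
Variables (phi : nat -> nat -> R) (rho : R).
Hypothesis q01 : forall e, 0 <= q e <= 1.
Hypothesis phi_sym : forall t t', phi t t' = phi t' t.
Hypothesis q_le_phi : forall e, expR (- phi (blk e.1) (blk e.2)) <= 1 - q e.
Hypothesis s_gt1 : (1 < s)%N.
Hypothesis M_gt0 : (0 < M)%N.
Hypothesis overlap_le : overlap_sum s M phi <= rho.

Local Notation pairs := (@transversal_pairs n s).

Lemma absent_prob_gt0 D : 0 < absent_prob q D.
Proof. by apply: prodr_gt0 => e _; apply: lt_le_trans (q_le_phi e); exact: expR_gt0. Qed.

Lemma overlap_top_le : expR (pair_energy phi [set: 'I_s]) <= rho * M%:R ^+ s.
Proof.
have Ms0 : 0 < M%:R ^+ s :> R by rewrite exprn_gt0 ?ltr0n.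
rewrite -ler_pdivrMr //; apply: le_trans overlap_le.
rewrite /overlap_sum (bigD1 [set: 'I_s]) /=; last by rewrite cardsT card_ord.
rewrite cardsT card_ord exprVn lerDl; apply: sumr_ge0 => I _.
by rewrite mulr_ge0 ?expR_ge0 // exprn_ge0 // invr_ge0.
Qed.

Section FixedVertexSet.
Variable V : {set 'I_n}.
Hypothesis large_blocks : forall t : 'I_s, (M <= #|block blk V t|)%N.
Local Notation trans := (transversals s blk V).

Lemma absent_prob_imset_ge f (I : {set 'I_s}) : f \in trans ->
  expR (- pair_energy phi I) <= absent_prob q (pairs_within (f @: I)).
Proof.
move=> fV; have finj := transversal_inj fV.
apply: (@le_trans _ _
    (\prod_(e in pairs_within (f @: I)) expR (- phi (blk e.1) (blk e.2)))); last first.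
  by apply: ler_prod => e _; rewrite expR_ge0 q_le_phi.
rewrite -expR_sum ler_expR sumrN lerN2 ler_pdivlMr // mulr_natr.
rewrite (sum_pairs_within (F := fun i j => phi (blk i) (blk j))) //.
rewrite big_imset /=; last by move=> a b _ _; exact: finj.
apply: ler_sum => t tI.
rewrite (eq_bigl (fun j => (j \in f @: I) && (j \in [set x | x != f t]))) => [|j]; last first.
  by rewrite inE.
rewrite big_mkcondr big_imset /=; last by move=> a b _ _; exact: finj.
rewrite -big_mkcondr (eq_bigl (fun t' => (t' \in I) && (t' != t))) => [|t'].
  by apply: ler_sum => t' _; rewrite !(transversal_blk _ fV).
by rewrite inE (inj_eq finj).
Qed.

Lemma absent_prob_pairs_le f g : f \in trans -> g \in trans ->
  absent_prob q (pairs f :|: pairs g) / (absent_prob q (pairs f) * absent_prob q (pairs g)) <=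
  expR (pair_energy phi (agreement f g)).
Proof.
move=> fV gV; rewrite ler_pdivrMr ?mulr_gt0 ?absent_prob_gt0 //.
rewrite -absent_probUI (transversal_pairsI fV gV) mulrCA -[leLHS]mulr1.
rewrite ler_wpM2l ?absent_prob_ge0 //.
apply: le_trans (ler_wpM2l (expR_ge0 _) (absent_prob_imset_ge (agreement f g) fV)).
by rewrite expRN mulfV // gt_eqF // expR_gt0.
Qed.

Lemma sum_dependent_pairs_le f : f \in trans ->
  \sum_(g in trans | dependent pairs f g)
    absent_prob q (pairs f :|: pairs g) / (absent_prob q (pairs f) * absent_prob q (pairs g))
  <= rho * #|trans|%:R.
Proof.
move=> fV; pose agreeing (I : {set 'I_s}) := [set g in trans | I \subset agreement f g].
have agreeing_le I : #|agreeing I|%:R <= #|trans|%:R * M%:R^-1 ^+ #|I| :> R.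
  rewrite exprVn ler_pdivlMr ?exprn_gt0 ?ltr0n // -natrX -natrM ler_nat.
  exact: card_transversals_agreeing.
apply: (@le_trans _ _ (\sum_(g in trans) \sum_(I : {set 'I_s} | (1 < #|I|)%N)
    (if I \subset agreement f g then expR (pair_energy phi I) else 0))).
  rewrite big_mkcondr; apply: ler_sum => g gV; case: ifP => [dep|_]; last first.
    by apply: sumr_ge0 => I _; case: ifP => // _; exact: expR_ge0.
  rewrite (bigD1 (agreement f g)) ?(dependent_transversals fV gV) //= subxx.
  rewrite -[leLHS]addr0 lerD ?absent_prob_pairs_le //.
  by apply: sumr_ge0 => I _; case: ifP => // _; exact: expR_ge0.
rewrite exchange_big /=; apply: le_trans (ler_wpM2r (ler0n _ _) overlap_le).
rewrite mulr_suml; apply: ler_sum => I _; rewrite -big_mkcondr /=.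
rewrite (eq_bigl (mem (agreeing I))) => [|g]; last by rewrite !inE.
by rewrite sumr_const -[leLHS]mulr_natr -mulrA ler_wpM2l ?expR_ge0 // mulrC.
Qed.

Lemma prob_no_independent_transversal_le :
  subset_prob (vpairs n) q
    (fun G => [forall f in trans, ~~ independent G (f @: [set: 'I_s])]) <= expR (- (4 * rho)^-1).
Proof.
have Ms0 : 0 < M%:R ^+ s :> R by rewrite exprn_gt0 ?ltr0n.
have rho0 : 0 < rho.
  by rewrite -(pmulr_lgt0 _ Ms0); apply: lt_le_trans overlap_top_le; exact: expR_gt0.
have card_ge : M%:R ^+ s <= #|trans|%:R :> R.
  by rewrite -natrX ler_nat; exact: card_transversals_ge.
have N0 : 0 < #|trans|%:R :> R by exact: lt_le_trans card_ge.
apply: (@janson_second_moment _ _ _ _ _ pairs) => //.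
- by move=> f; exact: pairs_within_sub.
- by rewrite -(ltr0n R).
- move=> f fV; apply: le_trans (absent_prob_imset_ge setT fV).
  rewrite expRN lef_pV2 ?posrE ?expR_gt0 ?mulr_gt0 //; apply: (le_trans overlap_top_le).
  by apply: ler_pM => //; [exact: ltW|lra].
- apply: le_trans (ler_sum _ sum_dependent_pairs_le) _.
  by rewrite sumr_const -[leLHS]mulr_natr expr2 mulrA.
Qed.

End FixedVertexSet.

Lemma prob_lacks_independent_transversal_le :
  subset_prob (vpairs n) q (lacks_independent_transversal s blk M) <= expR (n%:R - (4 * rho)^-1).
Proof.
apply: le_trans (subset_prob_exists_le _ q01 _ _) _.
apply: (@le_trans _ _ (\sum_(V : {set 'I_n}) 1 ^+ #|V| * expR (- (4 * rho)^-1))).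
  rewrite big_mkcond; apply: ler_sum => V _; rewrite expr1n mul1r.
  by case: ifP => [/forallP/prob_no_independent_transversal_le //|_]; exact: expR_ge0.
rewrite -mulr_suml sum_expr_card expRD ler_wpM2r ?expR_ge0 // card_ord -[n%:R]mul1r expRM_natr.
by rewrite lerXn2r ?nnegrE ?expR_ge0 ?expR_ge1Dx.
Qed.

(* Extracting k - M transversals leaves at most m vertices, whose induced
   subgraph is d-degenerate. *)
Lemma prob_chi_gt_le (k m d : nat) (a : R) :
  (forall e, q e <= a) -> 0 <= a -> (M <= k)%N ->
  (forall t : 'I_s, #|block blk [set: 'I_n] t| = k) ->
  (n <= m + s * (k - M))%N -> 4 * a * m%:R <= d%:R -> n%:R * expR (- (a * m%:R / 4)) <= 1 ->
  subset_prob (vpairs n) q (fun G => (k + d < chi G)%N)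
  <= expR (n%:R - (4 * rho)^-1) + expR (1 - a * m%:R / 4).
Proof.
move=> qa a0 Mk card_blocks nm amd nam.
apply: le_trans (lerD prob_lacks_independent_transversal_le
  (prob_exists_min_degree_ge_le q01 qa a0 amd nam)).
apply: le_trans (subset_prob_or_le _ q01 _ _).
apply: ler_subset_prob => // G sG; apply: contraTT; rewrite negb_or -leqNgt => /andP[rich sparse].
have [|Y [_ cY cardY]] := exists_colorable_on_transversals sG rich (j := k - M) (V := setT).
  by move=> t; rewrite card_blocks subnKC.
have rest_colorable : colorable_on G (~: Y) d.
  apply: colorable_on_degenerate => // X sX X0.
  move: sparse; rewrite negb_exists => /forallP/(_ X); rewrite card_gt0 X0 negb_and /=.
  case/orP=> //; rewrite (leq_trans (subset_leq_card sX)) //.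
  by rewrite cardsCs setCK cardY card_ord leq_subLR addnC.
apply: chi_le_colorable_on => //; apply: colorable_onS (colorable_onU cY rest_colorable).
- by rewrite leq_add2r leq_subr.
- by rewrite setUCr.
Qed.

End TransversalProbability.

(* The energy is at most 2|I| while p|I| <= 1, and at most (1 - d) L |I|
   always; the two ranges of |I| are summed separately. *)
Lemma overlap_sum_le (R : realType) (s M : nat) (phi : nat -> nat -> R) (p L d b : R) :
  0 < p -> 0 <= b -> 0 <= d * L ->
  (forall I : {set 'I_s}, pair_energy phi I <= 2 * p * #|I|%:R ^+ 2) ->
  (forall I : {set 'I_s}, (0 < #|I|)%N -> pair_energy phi I <= (1 - d) * L * #|I|%:R) ->
  expR b * (expR 2 / M%:R) * s%:R <= 1 ->
  expR (d * L / 2) * (expR ((1 - d) * L) / M%:R) * s%:R <= p^-1 ->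
  overlap_sum s M phi <= expR (1 - 2 * b) + expR (p^-1 * (1 - d * L / 2)).
Proof.
move=> p0 b0 dL0 energy_quadratic energy_linear small_range large_range.
pose z1 : R := expR 2 / M%:R; pose z2 := expR ((1 - d) * L) / M%:R.
have z1_ge0 : 0 <= z1 by rewrite divr_ge0 ?expR_ge0.
have z2_ge0 : 0 <= z2 by rewrite divr_ge0 ?expR_ge0.
have dL2 : 0 <= d * L / 2 by exact: divr_ge0.
apply: (@le_trans _ _ (\sum_(I : {set 'I_s} | 2 <= #|I|%:R :> R) z1 ^+ #|I| +
   \sum_(I : {set 'I_s} | p^-1 <= #|I|%:R :> R) z2 ^+ #|I|)); last first.
  apply: lerD.
    apply: le_trans (sum_large_expr_card_le _ _ z1_ge0 b0) _.
    by rewrite ler_expR card_ord [2 * b]mulrC lerD2r.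
  apply: le_trans (sum_large_expr_card_le _ _ z2_ge0 dL2) _.
  by rewrite ler_expR card_ord mulrBr mulr1 [p^-1 * _]mulrC lerD2r.
rewrite /overlap_sum [leLHS]big_mkcond [X in X + _]big_mkcond [X in _ + X]big_mkcond -big_split /=.
apply: ler_sum => I _; rewrite (ler_nat R 2); case: ifP => [I2|_]; last first.
  by rewrite add0r; case: ifP => // _; exact: exprn_ge0.
case: (lerP p^-1 #|I|%:R) => [large|small].
  rewrite -[leLHS]add0r lerD ?exprn_ge0 // /z2 exprMn -expRM_natr.
  by rewrite ler_wpM2r ?exprn_ge0 ?invr_ge0 ?ler_expR ?ler0n // energy_linear // ltnW.
rewrite addr0 /z1 exprMn -expRM_natr ler_wpM2r ?exprn_ge0 ?invr_ge0 ?ler0n // ler_expR.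
apply: (le_trans (energy_quadratic I)); rewrite expr2.
have pI : p * #|I|%:R <= 1 by rewrite -[leRHS](@mulfV _ p) ?gt_eqF // ler_pM2l // ltW.
have := ler_wpM2r (ler0n R #|I|) pI; lra.
Qed.

(** * Blocks of the vertices ordered by weight *)

Section WeightBlock.
Variables (R : realDomainType) (n : nat) (u : 'I_n -> R).

Definition weight_order : seq 'I_n := sort (fun i j => u j <= u i) (enum 'I_n).

Definition weight_rank (i : 'I_n) : nat := index i weight_order.

Definition weight_block (k : nat) (i : 'I_n) : nat := (weight_rank i %/ k)%N.

Lemma mem_weight_order i : i \in weight_order.
Proof. by rewrite mem_sort mem_enum. Qed.

Lemma weight_rank_ltn i : (weight_rank i < n)%N.
Proof. by have := mem_weight_order i; rewrite -index_mem size_sort size_enum_ord. Qed.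

Lemma weight_rank_inj : injective weight_rank.
Proof.
move=> i j ij; rewrite -(nth_index i (mem_weight_order i)) -/(weight_rank i) ij.
by rewrite nth_index ?mem_weight_order.
Qed.

Lemma weight_rank_anti i j : (weight_rank i < weight_rank j)%N -> u j <= u i.
Proof.
have sorted_u : sorted (fun i j => u j <= u i) weight_order.
  by apply: sort_sorted => a b; exact: le_total.
have trans_u : transitive (fun i j : 'I_n => u j <= u i).
  by move=> b a c ab bc; exact: le_trans bc ab.
move=> ij; have := sorted_ltn_nth trans_u i sorted_u (weight_rank i) (weight_rank j).
by rewrite !inE !index_mem !mem_weight_order !nth_index ?mem_weight_order //; apply.
Qed.

Lemma weight_block_anti k i j : (weight_block k i < weight_block k j)%N -> u j <= u i.
Proof.
move=> blt; apply: weight_rank_anti; rewrite ltnNge; apply: contraL blt => rle.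
by rewrite -leqNgt leq_div2r.
Qed.

Lemma card_weight_block k (t : 'I_(n %/ k)) : (0 < k)%N ->
  #|block (weight_block k) [set: 'I_n] t| = k.
Proof.
move=> k0; pose rank i := Ordinal (weight_rank_ltn i).
have rank_inj : injective rank by move=> i j /(congr1 val) /weight_rank_inj.
have in_range (a : 'I_k) : (t * k + a < n)%N.
  apply: (@leq_trans (t.+1 * k)); first by rewrite mulSn addnC ltn_add2r.
  by apply: leq_trans (leq_divM n k); rewrite leq_mul2r ltn_ord orbT.
pose in_block (a : 'I_k) := Ordinal (in_range a).
have in_block_inj : injective in_block by move=> a b /(congr1 val) /= /addnI /val_inj.
transitivity #|rank @^-1: (in_block @: [set: 'I_k])|; last first.
  by rewrite card_preimset // card_imset // cardsT card_ord.
apply: eq_card => i; rewrite !inE /=.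
apply/eqP/imsetP => [rank_div|[a _ /(congr1 val) /= rank_a]]; last first.
  by rewrite /weight_block rank_a divnMDl // (divn_small (ltn_ord a)) addn0.
have mod_lt : (weight_rank i %% k < k)%N by rewrite ltn_pmod.
by exists (Ordinal mod_lt); rewrite ?inE //; apply: ord_inj; rewrite /= -rank_div -divn_eq.
Qed.

End WeightBlock.

Section BlockMax.
Variables (R : realDomainType) (n : nat) (u : 'I_n -> R) (blk : 'I_n -> nat).
Hypothesis u01 : forall i, 0 <= u i <= 1.

Definition block_max (t : nat) : R := \big[Num.max/0]_(i | blk i == t) u i.

Lemma block_max01 t : 0 <= block_max t <= 1.
Proof.
apply: (big_ind (fun x => 0 <= x <= 1)) => [|x y|i _] //; first by rewrite lexx ler01.
by move=> /andP[x0 x1] /andP[y0 y1]; rewrite le_max x0 /= ge_max x1 y1.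
Qed.

Lemma le_block_max i : u i <= block_max (blk i).
Proof. by rewrite /block_max (bigD1 i) //= le_max lexx. Qed.

Variables (s k : nat).
Hypothesis blk_anti : forall i j, (blk i < blk j)%N -> u j <= u i.
Hypothesis card_blk : forall t : 'I_s, #|block blk [set: 'I_n] t| = k.

Lemma block_max_le i t : (blk i < t)%N -> block_max t <= u i.
Proof.
move=> it; apply: (big_ind (fun x => x <= u i)) => [|x y xu yu|j /eqP jt].
- by have /andP[] := u01 i.
- by rewrite ge_max xu yu.
- by apply: blk_anti; rewrite jt.
Qed.

Definition preceding_blocks (I : {set 'I_s}) : {set 'I_n} :=
  [set i | [exists t in I, (blk i).+1 == t]].

Lemma sum_preceding_blocks (V : nmodType) (g : 'I_n -> V) (I : {set 'I_s}) :
  \sum_(i in preceding_blocks I) g i =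
  \sum_(t in I | (0 < t)%N) \sum_(i | (blk i).+1 == t) g i.
Proof.
rewrite (exchange_big_dep xpredT) //= big_mkcond; apply: eq_bigr => i _.
rewrite inE; case: existsP => [[t /andP[tI /eqP blk_t]]|noblock].
  rewrite (bigD1 t) /= ?tI -?blk_t ?eqxx // big1 ?addr0 // => t' /andP[/andP[_ /eqP blk_t']].
  by rewrite -val_eqE /= -blk_t -blk_t' eqxx.
rewrite big_pred0 // => t; apply/negbTE/negP => /andP[/andP[tI _] blk_t].
by apply: noblock; exists t; rewrite tI.
Qed.

Lemma card_preceding_block (t : 'I_s) : (0 < t)%N -> #|[set i | (blk i).+1 == t]| = k.
Proof.
move=> t0; have pred_lt : (t.-1 < s)%N by apply: leq_ltn_trans (ltn_ord t); exact: leq_pred.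
rewrite -(card_blk (Ordinal pred_lt)); apply: eq_card => i; rewrite !inE /=.
by rewrite -[in LHS](prednK t0) eqSS.
Qed.

Lemma card_preceding_blocks_le (I : {set 'I_s}) : (#|preceding_blocks I| <= k * #|I|)%N.
Proof.
rewrite -sum1_card (sum_preceding_blocks (fun=> 1%N)) mulnC -sum_nat_const big_mkcondr.
apply: leq_sum => t _; case: ifP => // t0.
by rewrite -(card_preceding_block t0) -sum1_card; apply/eq_leq/eq_bigl => i; rewrite inE.
Qed.

(* The maximum of a block is at most every weight in the preceding block, so
   the block maxima, apart from the first one, are dominated by averages over
   preceding blocks. *)
Lemma sum_block_max_le (I : {set 'I_s}) :
  k%:R * (\sum_(t in I) block_max t - 1) <= \sum_(i in preceding_blocks I) u i.
Proof.
have w0 t : 0 <= block_max t by have /andP[] := block_max01 t.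
rewrite sum_preceding_blocks.
apply: (@le_trans _ _ (k%:R * \sum_(t in I | (0 < t)%N) block_max t)).
  rewrite ler_wpM2l // lerBlDr (bigID (fun t : 'I_s => (0 < t)%N)) /= lerD2l.
  have [s0|s0] := posnP s; first by rewrite big1 ?ler01 // => t; have := ltn_ord t; rewrite {2}s0.
  apply: (@le_trans _ _ (\sum_(t | t == Ordinal s0) block_max t)); last first.
    by rewrite big_pred1_eq; have /andP[] := block_max01 (Ordinal s0).
  rewrite big_mkcond [leRHS]big_mkcond; apply: ler_sum => t _.
  case: ifP => [/andP[_ t0]|_]; last by case: ifP.
  suff -> : t == Ordinal s0 by [].
  by rewrite -val_eqE /= -leqn0 leqNgt.
rewrite mulr_sumr; apply: ler_sum => t /andP[_ t0].
rewrite -(card_preceding_block t0) mulrC mulr_natr -sumr_const.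
under eq_bigl => i do rewrite inE.
by apply: ler_sum => i /eqP bt; apply: block_max_le; rewrite -bt.
Qed.

End BlockMax.

(** * Energies of the two kernels *)

Section MaxDensity.
Variables (R : realFieldType) (n : nat) (u : 'I_n -> R).
Implicit Types U S : {set 'I_n}.

Lemma sqr_sum_le_max_density U : (\sum_(i in U) u i) ^+ 2 <= max_density u * #|U|%:R.
Proof.
have [U0|U0] := posnP #|U|.
  by rewrite U0 mulr0 (cards0_eq U0) big_set0 expr0n.
by rewrite -ler_pdivrMr ?ltr0n // mulrC /max_density (bigD1 U) //= le_max lexx.
Qed.

Lemma max_density_ge0 : 0 <= max_density u.
Proof.
rewrite /max_density; apply: (big_ind (fun x => 0 <= x)) => // [x y x0 _|U _].
  by rewrite le_max x0.
by rewrite mulr_ge0 ?invr_ge0 // sqr_ge0.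
Qed.

Lemma max_density_le_bound (b : R) : 0 <= b ->
  (forall U, (\sum_(i in U) u i) ^+ 2 <= b * #|U|%:R) -> max_density u <= b.
Proof.
move=> b0 sqr_le; apply: (big_ind (fun x => x <= b)) => // [x y xb yb|U U0].
  by rewrite ge_max xb yb.
by rewrite ler_pdivrMl ?ltr0n // mulrC.
Qed.

Hypothesis u01 : forall i, 0 <= u i <= 1.

Lemma sum_weights_ge0 S : 0 <= \sum_(i in S) u i.
Proof. by apply: sumr_ge0 => i _; have /andP[] := u01 i. Qed.

Lemma sum_weights_le_card S : \sum_(i in S) u i <= #|S|%:R.
Proof. by rewrite -sumr_const; apply: ler_sum => i _; have /andP[] := u01 i. Qed.

Lemma max_density_le : max_density u <= n%:R.
Proof.
apply: max_density_le_bound => // U; rewrite expr2 ler_pM ?sum_weights_ge0 ?sum_weights_le_card //.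
by apply: le_trans (sum_weights_le_card U) _; rewrite ler_nat -[X in (_ <= X)%N]card_ord max_card.
Qed.

End MaxDensity.

Section PairEnergy.
Variables (R : realFieldType) (s : nat) (phi : nat -> nat -> R).
Implicit Type I : {set 'I_s}.

Lemma pair_energy_le I : (forall t t', 0 <= phi t t') ->
  pair_energy phi I <= (\sum_(t in I) \sum_(t' in I) phi t t') / 2.
Proof.
move=> phi0; rewrite /pair_energy ler_pM2r ?invr_gt0 //.
apply: ler_sum => t _; rewrite big_mkcondr; apply: ler_sum => t' _.
by case: ifP.
Qed.

Lemma pair_energy_le_sqr (a : R) I : (forall t t', 0 <= phi t t' <= a) ->
  pair_energy phi I <= a * #|I|%:R ^+ 2 / 2.
Proof.
move=> phi_le; apply: le_trans (pair_energy_le _ _) _ => [t t'|].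
  by have /andP[] := phi_le t t'.
rewrite ler_pM2r ?invr_gt0 //.
apply: (@le_trans _ _ (\sum_(t in I) \sum_(t' in I) a)).
  by apply: ler_sum => t _; apply: ler_sum => t' _; have /andP[] := phi_le t t'.
by rewrite !sumr_const -mulrnA -[_ *+ _]mulr_natr natrM.
Qed.

End PairEnergy.

Section BlockEnergy.
Variables (R : realFieldType) (n s k : nat) (u : 'I_n -> R) (blk : 'I_n -> nat).
Variables (p L d : R).
Hypothesis u01 : forall i, 0 <= u i <= 1.
Hypothesis blk_anti : forall i j, (blk i < blk j)%N -> u j <= u i.
Hypothesis card_blk : forall t : 'I_s, #|block blk [set: 'I_n] t| = k.
Hypothesis k_gt0 : (0 < k)%N.
Hypothesis p_ge0 : 0 <= p.
Hypothesis d01 : 0 < d <= 1.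
Hypothesis p_le : 16 * p <= d.
Hypothesis L_ge : 32 <= d * L.
Local Notation w := (block_max u blk).

Lemma sum_block_max_le_average (I : {set 'I_s}) :
  \sum_(t in I) w t <= 1 + (\sum_(i in preceding_blocks blk I) u i) / k%:R.
Proof.
by rewrite -lerBlDl ler_pdivlMr ?ltr0n // mulrC (sum_block_max_le u01 blk_anti card_blk).
Qed.

Lemma block_max_ge0 t : 0 <= w t.
Proof. by have /andP[] := block_max01 blk u01 t. Qed.

Lemma add_kernel_energy_le (I : {set 'I_s}) :
  (1 + d / 2) * (p * \sum_i u i) <= L * k%:R ->
  pair_energy (fun t t' => (1 + d / 16) * (p * (w t + w t'))) I <= (1 - d / 16) * L * #|I|%:R.
Proof.
have /andP[d0 d1] := d01; move=> weight_le.
apply: le_trans (pair_energy_le _ _) _ => [t t'|].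
  by rewrite !mulr_ge0 ?addr_ge0 ?block_max_ge0 // divr_ge0 // ltW.
set W := \sum_(t in I) w t.
have -> : \sum_(t in I) \sum_(t' in I) (1 + d / 16) * (p * (w t + w t'))
   = 2 * ((1 + d / 16) * p * W * #|I|%:R).
  under eq_bigr => t _ do rewrite -!mulr_sumr big_split /= sumr_const.
  by rewrite -!mulr_sumr big_split /= sumr_const sumrMnl -/W; ring.
rewrite mulrAC divff ?pnatr_eq0 // mul1r ler_wpM2r //.
set x := (\sum_i u i) / k%:R.
have Wx : W <= 1 + x.
  apply: le_trans (sum_block_max_le_average I) _; rewrite lerD2l ler_pM2r ?invr_gt0 ?ltr0n //.
  by rewrite big_mkcond ler_sum // => i _; have /andP[ui0 _] := u01 i; case: ifP.
have xL : (1 + d / 2) * (p * x) <= L by rewrite /x !mulrA ler_pdivrMr ?ltr0n // -mulrA.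
have px0 : 0 <= p * x.
  by rewrite mulr_ge0 // divr_ge0 // sumr_ge0 // => i _; have /andP[] := u01 i.
have shrink : 1 + d / 16 <= (1 - d / 8) * (1 + d / 2).
  have := ler_wpM2l (ltW d0) d1; lra.
have others : (1 + d / 16) * (p * x) <= (1 - d / 8) * L.
  apply: le_trans (ler_wpM2r px0 shrink) _; rewrite -mulrA ler_wpM2l //; lra.
have first_block : (1 + d / 16) * p <= d / 16 * L.
  have := ler_wpM2l p_ge0 d1; have := p_le; have := L_ge; lra.
have : (1 + d / 16) * p * W <= (1 + d / 16) * p * (1 + x).
  by rewrite ler_wpM2l // mulr_ge0 //; lra.
lra.
Qed.

Lemma sqr_preceding_average_le (I : {set 'I_s}) :
  ((\sum_(i in preceding_blocks blk I) u i) / k%:R) ^+ 2 * k%:R <= max_density u * #|I|%:R.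
Proof.
have k0 : 0 < k%:R :> R by rewrite ltr0n.
rewrite expr_div_n mulrAC ler_pdivrMr ?exprn_gt0 // expr2 mulrA ler_pM2r // -mulrA -natrM.
apply: le_trans (sqr_sum_le_max_density _ _) _.
by rewrite ler_wpM2l ?max_density_ge0 // ler_nat mulnC card_preceding_blocks_le.
Qed.

Lemma mul_kernel_energy_le (I : {set 'I_s}) : (0 < #|I|)%N ->
  (1 + d / 2) * (p * max_density u) <= 2 * L * k%:R ->
  pair_energy (fun t t' => (1 + d / 16) * (p * (w t * w t'))) I <= (1 - d / 16) * L * #|I|%:R.
Proof.
have /andP[d0 d1] := d01; move=> I0 density_le.
apply: le_trans (pair_energy_le _ _) _ => [t t'|].
  by rewrite !mulr_ge0 ?block_max_ge0 // addr_ge0 // divr_ge0 // ltW.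
set W := \sum_(t in I) w t.
have -> : \sum_(t in I) \sum_(t' in I) (1 + d / 16) * (p * (w t * w t'))
   = (1 + d / 16) * p * W ^+ 2.
  rewrite expr2 /W mulr_suml mulr_sumr; apply: eq_bigr => t _.
  by rewrite !mulr_sumr; apply: eq_bigr => t' _; rewrite !mulrA.
set x := (\sum_(i in preceding_blocks blk I) u i) / k%:R.
have xL : (1 + d / 2) * (p * x ^+ 2) <= 2 * (L * #|I|%:R).
  rewrite -(ler_pM2r (_ : 0 < k%:R)) ?ltr0n //.
  have cp0 : 0 <= (1 + d / 2) * p by rewrite mulr_ge0 //; lra.
  have := ler_wpM2l cp0 (sqr_preceding_average_le I); rewrite -/x.
  have := ler_wpM2r (ler0n R #|I|) density_le; lra.
have W2 : W ^+ 2 <= 1 + (d / 16)^-1 + (1 + d / 16) * x ^+ 2.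
  apply: le_trans (sqrr_1D_le _ (divr_gt0 d0 (ltr0n R 16))).
  have x0 : 0 <= x by rewrite divr_ge0 ?sum_weights_ge0.
  have W0 : 0 <= W by apply: sumr_ge0 => t _; exact: block_max_ge0.
  by rewrite lerXn2r ?nnegrE ?addr_ge0 // sum_block_max_le_average.
have shrink : (1 + d / 16) ^+ 2 <= (1 - d / 8) * (1 + d / 2).
  have := ler_wpM2l (ltW d0) d1; rewrite !expr2; lra.
have others : (1 + d / 16) ^+ 2 * (p * x ^+ 2) <= 2 * (1 - d / 8) * (L * #|I|%:R).
  apply: le_trans (ler_wpM2r _ shrink) _; first by rewrite mulr_ge0 ?sqr_ge0.
  have d8_ge0 : 0 <= 1 - d / 8 by lra.
  have := ler_wpM2l d8_ge0 xL; lra.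
have first_block : (1 + d / 16) * p * (1 + (d / 16)^-1) <= d / 8 * (L * #|I|%:R).
  have p_div_le1 : p * (d / 16)^-1 <= 1 by rewrite ler_pdivrMr ?divr_gt0 //; have := p_le; lra.
  have := ler_wpM2l (ltW d0) p_div_le1; have := ler_wpM2l p_ge0 d1; have := p_le.
  have := ler_wpM2r (ler0n R #|I|) L_ge; have : 1 <= #|I|%:R :> R by rewrite ler1n.
  lra.
have dp0 : 0 <= (1 + d / 16) * p by rewrite mulr_ge0 //; lra.
have := ler_wpM2l dp0 W2; rewrite expr2 in others; lra.
Qed.

End BlockEnergy.

(** * Numerical estimates in the dense regime *)

(* What the argument needs of large n; c is a lower bound for Y ln (p n) / (p n),
   where Y is the predicted chromatic number. *)
Record dense_regime (R : realType) (n : nat) (p c d : R) : Prop := DenseRegime {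
  regime_p_gt0 : 0 < p;
  regime_p_le : 256 * p <= d;
  regime_c_itv : 0 < c <= 1;
  regime_d_itv : 0 < d <= 1;
  regime_ln_ge : 64 <= d * c * ln (p * n%:R);
  regime_sqrt_ge : expR 5 * ln (p * n%:R) ^+ 4 <= c ^+ 2 * p ^+ 2 * Num.sqrt n%:R;
  regime_expR_ge : ln (p * n%:R) ^+ 4 <= c ^+ 2 * expR (d / 32 * ln (p * n%:R)) }.

Section DenseRegime.
Variables (R : realType) (n : nat) (p c d : R).
Hypothesis reg : dense_regime n p c d.
Local Notation L := (ln (p * n%:R)).

Lemma regime_p01 : 0 <= p <= 1.
Proof. by have [p0 pd _ /andP[_ d1] _ _ _] := reg; apply/andP; split; lra. Qed.

Lemma regime_dL_ge : 64 <= d * L.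
Proof.
have [_ _ /andP[c0 c1] /andP[d0 _] dcL _ _] := reg.
have L0 : 0 < L by rewrite -(pmulr_rgt0 _ (mulr_gt0 d0 c0)); lra.
by apply: le_trans dcL _; rewrite -mulrA ler_pM2l // -[leRHS]mul1r ler_pM2r.
Qed.

Lemma regime_L_ge : 64 <= L.
Proof.
have [_ _ _ /andP[d0 d1] _ _ _] := reg; have dL := regime_dL_ge.
have L0 : 0 < L by rewrite -(pmulr_rgt0 _ d0); lra.
by apply: le_trans dL _; rewrite -[leRHS]mul1r ler_pM2r.
Qed.

Lemma regime_n_gt0 : 0 < n%:R :> R.
Proof.
have := regime_L_ge; rewrite ltr0n lt0n; apply: contraTN => /eqP ->.
by rewrite mulr0 ln0 // -ltNge.
Qed.

Lemma regime_expR_ln : expR L = p * n%:R.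
Proof. by have [p0 _ _ _ _ _ _] := reg; rewrite lnK // posrE mulr_gt0 ?regime_n_gt0. Qed.

Lemma regime_L_le_n : L <= n%:R.
Proof.
have [p0 pd _ /andP[_ d1] _ _ _] := reg.
have := expR_ge1Dx L; rewrite regime_expR_ln.
have : p * n%:R <= 1 * n%:R by rewrite ler_wpM2r //; lra.
lra.
Qed.

Lemma regime_c2p2n_ge : 6 * L ^+ 2 <= c ^+ 2 * p ^+ 2 * n%:R.
Proof.
have [p0 _ /andP[c0 _] _ _ sqrt_ge _] := reg; have L64 := regime_L_ge.
have sqrt_le : Num.sqrt n%:R <= n%:R :> R.
  have n1 : 1 <= n%:R :> R by rewrite ler1n -(ltr0n R) regime_n_gt0.
  rewrite -[leRHS]sqr_sqrtr // expr2 ler_peMr ?sqrtr_ge0 //.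
  by rewrite -[leLHS]sqrtr1 ler_wsqrtr.
apply: (@le_trans _ _ (expR 5 * L ^+ 4)).
  apply: ler_pM; rewrite ?exprn_ge0 //; [lra|exact: le_trans (expR_ge1Dx _)|].
  by rewrite ler_eXn2l //; lra.
by apply: (le_trans sqrt_ge); rewrite ler_wpM2l // mulr_ge0 ?sqr_ge0.
Qed.

Lemma regime_cp2n_ge : 6 * L ^+ 2 <= c * p ^+ 2 * n%:R.
Proof.
have [_ _ /andP[c0 c1] _ _ _ _] := reg.
by apply: le_trans regime_c2p2n_ge _; rewrite !ler_wpM2r ?sqr_ge0 // expr2 ler_piMr // ltW.
Qed.

Lemma regime_dc2pn_ge : 256 * L ^+ 2 <= d * c ^+ 2 * (p * n%:R).
Proof.
have [p0 pd _ _ _ _ _] := reg.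
have := ler_wpM2r (mulr_ge0 (sqr_ge0 c) (mulr_ge0 (ltW p0) (ler0n R n))) pd.
have := regime_c2p2n_ge; have := sqr_ge0 L; rewrite !expr2; lra.
Qed.

Lemma regime_ln_n_le : ln n%:R <= 2 * L.
Proof.
have [p0 _ /andP[c0 c1] _ _ _ _] := reg; have n0 := regime_n_gt0; have L64 := regime_L_ge.
have p2n : 1 <= p ^+ 2 * n%:R.
  have L2 : 1 <= L ^+ 2 by rewrite exprn_ege1 //; lra.
  have := regime_cp2n_ge; rewrite -mulrA => /le_trans/(_ (ler_piMl _ c1)) cp2n.
  have := cp2n (mulr_ge0 (sqr_ge0 p) (ltW n0)); lra.
rewrite mulr_natl -lnXn ?mulr_gt0 // ler_ln ?posrE ?exprn_gt0 ?mulr_gt0 //.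
by rewrite exprMn [n%:R ^+ 2]expr2 mulrA ler_peMl // ltW.
Qed.

Lemma regime_first_moment_le : expR ((4 - d * L ^+ 2) / p) <= expR (- L).
Proof.
have [p0 pd _ /andP[_ d1] _ _ _] := reg; have L64 := regime_L_ge; have dL := regime_dL_ge.
have dL2 : 64 * L <= d * L ^+ 2 by rewrite expr2 mulrA ler_wpM2r //; lra.
have pL : p * L <= 1 * L by rewrite ler_wpM2r //; lra.
by rewrite ler_expR ler_pdivrMr //; lra.
Qed.

End DenseRegime.

(* The number of vertices per block, and the number of disjoint transversals
   that serve as colour classes. *)
Definition block_size (R : realType) (d Y : R) : nat := (Num.truncn ((1 + d / 2) * Y)).+1.

Section RegimeColoring.
Variables (R : realType) (n : nat) (p c d Y : R).
Hypothesis reg : dense_regime n p c d.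
Local Notation L := (ln (p * n%:R)).
Hypothesis Y_ge : c * (p * n%:R) <= Y * L.
Hypothesis Y_le : Y * L <= p * n%:R.
Local Notation k := (block_size d Y).
Local Notation s := (n %/ block_size d Y)%N.

(* The number of vertices per block that the extraction of independent
   transversals leaves over. *)
Definition reserve_size : nat := (Num.truncn (k%:R / L ^+ 2)).+1.
Local Notation M := reserve_size.

(* The summand k accounts for the n %% k vertices outside the s blocks. *)
Definition leftover_size : nat := (k + s * M)%N.

Definition leftover_colors : nat := (Num.truncn (8 * p * leftover_size%:R)).+1.

Lemma regime_dcY_ge : 256 * L <= d * c * Y.
Proof.
have [_ _ /andP[c0 _] /andP[d0 _] _ _ _] := reg; have L64 := regime_L_ge reg.
have L0 : 0 < L by lra.
rewrite -(ler_pM2r L0); have := ler_wpM2l (mulr_ge0 (ltW d0) (ltW c0)) Y_ge.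
by have := regime_dc2pn_ge reg; rewrite !expr2; lra.
Qed.

Lemma regime_dY_ge : 256 * L <= d * Y.
Proof.
have [_ _ /andP[c0 c1] /andP[d0 _] _ _ _] := reg; have L64 := regime_L_ge reg.
have Y0 : 0 < Y.
  by rewrite -(pmulr_rgt0 _ (mulr_gt0 d0 c0)); have := regime_dcY_ge; lra.
by apply: le_trans regime_dcY_ge _; rewrite ler_pM2r // ler_piMr // ltW.
Qed.

Lemma regime_Y_gt0 : 0 < Y.
Proof.
have [_ _ _ /andP[d0 _] _ _ _] := reg; have L64 := regime_L_ge reg.
by rewrite -(pmulr_rgt0 _ d0); have := regime_dY_ge; lra.
Qed.

Lemma block_size_ge : (1 + d / 2) * Y <= k%:R.
Proof. by rewrite ltW // truncnS_gt. Qed.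

Lemma block_size_le : k%:R <= (1 + d / 2) * Y + 1.
Proof.
have [_ _ _ /andP[d0 _] _ _ _] := reg; have Y0 := regime_Y_gt0.
by rewrite /block_size -natr1 lerD2r truncn_le mulr_ge0 ?(ltW Y0) //; lra.
Qed.

Lemma block_size_between : Y <= k%:R <= 2 * Y.
Proof.
have [_ _ _ /andP[d0 d1] _ _ _] := reg; have Y0 := regime_Y_gt0; have L64 := regime_L_ge reg.
have dY := regime_dY_ge; have dYY : d * Y <= 1 * Y by rewrite ler_pM2r.
have := block_size_ge; have := block_size_le; lra.
Qed.

Lemma block_size_mul_L_ge : c * (p * n%:R) <= k%:R * L.
Proof.
have L64 := regime_L_ge reg; apply: (le_trans Y_ge); rewrite ler_wpM2r //; first by lra.
by have /andP[] := block_size_between.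
Qed.

Lemma block_count_mul_le : s%:R * k%:R <= n%:R :> R.
Proof. by rewrite -natrM ler_nat leq_divM. Qed.

Lemma block_count_gt1 : (1 < s)%N.
Proof.
have [p0 pd _ /andP[d0 d1] _ _ _] := reg; have Y0 := regime_Y_gt0; have L64 := regime_L_ge reg.
have /andP[_ kY] := block_size_between.
rewrite leq_divRL // -(ler_nat R) natrM.
have YL : Y * 64 <= Y * L by rewrite ler_pM2l.
have pn : p * n%:R <= 1 * n%:R by rewrite ler_wpM2r //; lra.
have := Y_le; lra.
Qed.

Lemma reserve_size_ge : k%:R <= M%:R * L ^+ 2.
Proof.
have L64 := regime_L_ge reg.
by rewrite -ler_pdivrMr ?exprn_gt0 //; [rewrite ltW // truncnS_gt|lra].
Qed.

Lemma reserve_size_le : M%:R <= k%:R / L ^+ 2 + 1.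
Proof. by rewrite /reserve_size -natr1 lerD2r truncn_le divr_ge0 ?sqr_ge0. Qed.

Lemma reserve_size_le_block_size : (M <= k)%N.
Proof.
have L64 := regime_L_ge reg; have /andP[Yk _] := block_size_between.
have dY := regime_dY_ge; have [_ _ _ /andP[_ d1] _ _ _] := reg.
have dYY : d * Y <= 1 * Y by rewrite ler_pM2r ?regime_Y_gt0.
rewrite -(ler_nat R); apply: le_trans reserve_size_le _.
suff : k%:R / L ^+ 2 <= k%:R / 2 by lra.
rewrite ler_pM2l ?ltr0n // lef_pV2 ?posrE ?exprn_gt0 //; last by lra.
by rewrite expr2; have := ler_pM (ler0n R 64) (ler0n R 64) L64 L64; lra.
Qed.

Lemma block_count_le : s%:R <= L / (c * p).
Proof.
have [p0 _ /andP[c0 _] _ _ _ _] := reg; have n0 := regime_n_gt0 reg; have L64 := regime_L_ge reg.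
rewrite ler_pdivlMr ?mulr_gt0 // -(ler_pM2r n0).
have := ler_wpM2l (ler0n R s) block_size_mul_L_ge.
have L0 : 0 <= L by lra.
have := ler_wpM2r L0 block_count_mul_le; lra.
Qed.

(* Both sides are compared with s (k L)^2. *)
Lemma block_count_le_reserve : s%:R * (c ^+ 2 * p ^+ 2 * n%:R) <= L ^+ 4 * M%:R.
Proof.
have [p0 _ /andP[c0 _] _ _ _ _] := reg; have n0 := regime_n_gt0 reg; have L64 := regime_L_ge reg.
have L0 : 0 <= L by lra.
rewrite -(ler_pM2r n0).
have cpn0 : 0 <= c * (p * n%:R) by rewrite !mulr_ge0 // ltW.
apply: (@le_trans _ _ (s%:R * (k%:R * L) ^+ 2)).
  rewrite [leLHS](_ : _ = s%:R * (c * (p * n%:R)) ^+ 2); last by ring.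
  by rewrite ler_wpM2l // lerXn2r ?block_size_mul_L_ge ?nnegrE ?(mulr_ge0 _ L0).
apply: (@le_trans _ _ (n%:R * L ^+ 2 * k%:R)).
  rewrite [leLHS](_ : _ = s%:R * k%:R * (L ^+ 2 * k%:R)); last by ring.
  by rewrite -[leRHS]mulrA ler_wpM2r ?mulr_ge0 ?sqr_ge0 ?block_count_mul_le.
rewrite [leRHS](_ : _ = n%:R * L ^+ 2 * (M%:R * L ^+ 2)); last by ring.
by rewrite ler_wpM2l ?reserve_size_ge // mulr_ge0 ?sqr_ge0.
Qed.

Lemma sqrt_block_count_le_reserve : expR 5 * Num.sqrt n%:R * s%:R <= M%:R :> R.
Proof.
have [_ _ _ _ _ sqrt_ge _] := reg; have L64 := regime_L_ge reg.
have L4 : 0 < L ^+ 4 by rewrite exprn_gt0 //; lra.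
rewrite -(ler_pM2l L4); apply: le_trans block_count_le_reserve.
rewrite [leLHS](_ : _ = expR 5 * L ^+ 4 * (Num.sqrt n%:R * s%:R)); last by ring.
rewrite [leRHS](_ : _ = c ^+ 2 * p ^+ 2 * Num.sqrt n%:R * (Num.sqrt n%:R * s%:R)).
  by rewrite ler_wpM2r // mulr_ge0 ?sqrtr_ge0.
by rewrite -{1}[n%:R]sqr_sqrtr //; ring.
Qed.

Lemma large_block_count_le_reserve : p * s%:R * expR L <= M%:R * expR (d / 32 * L).
Proof.
have [p0 _ /andP[c0 _] _ _ _ exp_ge] := reg.
have c2_gt0 : 0 < c ^+ 2 by exact: exprn_gt0.
rewrite (regime_expR_ln reg) -(ler_pM2l c2_gt0).
apply: (@le_trans _ _ (L ^+ 4 * M%:R)).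
  by apply: le_trans block_count_le_reserve; rewrite !expr2; lra.
have := ler_wpM2r (ler0n R M) exp_ge; lra.
Qed.

Lemma regime_overlap_sum_le (phi : nat -> nat -> R) :
  (forall I : {set 'I_s}, pair_energy phi I <= 2 * p * #|I|%:R ^+ 2) ->
  (forall I : {set 'I_s}, (0 < #|I|)%N ->
     pair_energy phi I <= (1 - d / 16) * L * #|I|%:R) ->
  overlap_sum s M phi <= (16 * n%:R)^-1.
Proof.
have [p0 pd _ /andP[d0 _] _ _ _] := reg; have n0 := regime_n_gt0 reg; have L64 := regime_L_ge reg.
have dL := regime_dL_ge reg; have M0 : 0 < M%:R :> R by rewrite ltr0n.
have ln_n0 : 0 <= ln (n%:R : R) by rewrite ln_ge0 // ler1n -(ltr0n R).
move=> quadratic linear.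
have b_ge0 : 0 <= ln (n%:R : R) / 2 + 3 by lra.
have dL_ge0 : 0 <= d / 16 * L by lra.
apply: le_trans (overlap_sum_le p0 b_ge0 dL_ge0 quadratic linear _ _) _.
- rewrite mulrA mulrAC ler_pdivrMr // mul1r -expRD.
  rewrite (_ : _ + 3 + 2 = 5 + ln n%:R / 2); last by lra.
  by rewrite expRD expR_ln_half // sqrt_block_count_le_reserve.
- rewrite mulrA mulrAC ler_pdivrMr // -expRD [leRHS]mulrC ler_pdivlMr //.
  rewrite (_ : _ + _ = L - d / 32 * L); last by lra.
  rewrite expRB -!mulrA mulrCA [_^-1 * _]mulrC mulrA ler_pdivrMr ?expR_gt0 //.
  by have := large_block_count_le_reserve; lra.
have exponent_ge : 4 * L <= p^-1 * (d / 16 * L / 2 - 1).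
  rewrite ler_pdivlMl //; have L0 : 0 <= L by lra.
  have := ler_wpM2r L0 pd; lra.
have summand_le : expR (- 5 - ln n%:R) <= (32 * n%:R)^-1 :> R.
  rewrite -opprD expRN expRD lnK // lef_pV2 ?posrE ?mulr_gt0 ?expR_gt0 //.
  by rewrite ler_pM2r // expR5_ge32.
have -> : (16 * n%:R)^-1 = (32 * n%:R)^-1 + (32 * n%:R)^-1 :> R by field; rewrite gt_eqF.
apply: lerD; apply: le_trans summand_le; rewrite ler_expR; first by lra.
by have := regime_ln_n_le reg; lra.
Qed.

Lemma mul_leftover_size_ge : 6 * L <= p * leftover_size%:R.
Proof.
have [p0 _ _ _ _ _ _] := reg; have L64 := regime_L_ge reg.
have L0 : 0 < L by lra.
apply: (@le_trans _ _ (p * k%:R)); last by rewrite ler_pM2l // ler_nat leq_addr.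
rewrite -(ler_pM2r L0).
have := ler_wpM2l (ltW p0) block_size_mul_L_ge.
have := regime_cp2n_ge reg; rewrite !expr2; lra.
Qed.

Lemma leftover_size_le : leftover_size%:R <= 2 * Y + n%:R / L ^+ 2 + L / (c * p).
Proof.
have /andP[_ kY] := block_size_between.
rewrite /leftover_size natrD natrM -addrA lerD //.
apply: le_trans (ler_wpM2l (ler0n R s) reserve_size_le) _.
rewrite mulrDr mulr1 mulrA lerD ?block_count_le // ler_wpM2r ?block_count_mul_le //.
by rewrite invr_ge0 sqr_ge0.
Qed.

Lemma block_size_leftover_colors_le : (k + leftover_colors)%:R <= (1 + d) * Y.
Proof.
have [p0 pd /andP[c0 _] /andP[d0 _] dcL _ _] := reg; have L64 := regime_L_ge reg.
have L0 : 0 < L by lra.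
have Y0 := regime_Y_gt0.
have colors_le : leftover_colors%:R <= 8 * p * leftover_size%:R + 1.
  by rewrite /leftover_colors -natr1 lerD2r truncn_le !mulr_ge0 // ltW.
have block_term : 8 * p * (2 * Y) <= d / 16 * Y.
  have := ler_wpM2r (ltW Y0) pd; lra.
have reserve_term : 8 * p * (n%:R / L ^+ 2) <= d / 8 * Y.
  rewrite mulrA ler_pdivrMr ?exprn_gt0 // -(ler_pM2l c0).
  have := ler_wpM2r (mulr_ge0 (ltW Y0) (ltW L0)) dcL.
  have := Y_ge; rewrite expr2; lra.
have count_term : 8 * p * (L / (c * p)) <= d / 32 * Y.
  rewrite (_ : 8 * p * (L / (c * p)) = 8 * L / c); last by field; rewrite !gt_eqF.
  by rewrite ler_pdivrMr //; have := regime_dcY_ge; lra.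
have p8_ge0 : 0 <= 8 * p by rewrite mulr_ge0 // ltW.
have := ler_wpM2l p8_ge0 leftover_size_le; rewrite !mulrDr natrD.
have := block_size_le; have := regime_dY_ge; lra.
Qed.

Lemma regime_prob_chi_gt_le (q : 'I_n * 'I_n -> R) (blk : 'I_n -> nat) (phi : nat -> nat -> R) :
  (forall e, 0 <= q e <= 1) -> (forall e, q e <= 2 * p) ->
  (forall t t', phi t t' = phi t' t) ->
  (forall e, expR (- phi (blk e.1) (blk e.2)) <= 1 - q e) ->
  (forall t : 'I_s, #|block blk [set: 'I_n] t| = k) ->
  (forall I : {set 'I_s}, pair_energy phi I <= 2 * p * #|I|%:R ^+ 2) ->
  (forall I : {set 'I_s}, (0 < #|I|)%N -> pair_energy phi I <= (1 - d / 16) * L * #|I|%:R) ->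
  subset_prob (vpairs n) q (fun G => (1 + d) * Y < (chi G)%:R) <= 2 * expR (- L).
Proof.
move=> q01 qp phi_sym q_le_phi card_blk quadratic linear.
have [p0 _ _ _ _ _ _] := reg; have n0 := regime_n_gt0 reg; have L64 := regime_L_ge reg.
have pm := mul_leftover_size_ge; have Ln := regime_L_le_n reg.
apply: (@le_trans _ _ (subset_prob (vpairs n) q (fun G => (k + leftover_colors < chi G)%N))).
  apply: ler_subset_prob => // G _; rewrite -(ltr_nat R).
  exact: le_lt_trans block_size_leftover_colors_le.
have overlap_le := regime_overlap_sum_le quadratic linear.
apply: le_trans (prob_chi_gt_le (m := leftover_size) q01 phi_sym q_le_phi block_count_gt1 _
  overlap_le qp _ reserve_size_le_block_size card_blk _ _ _) _ => //.
- by rewrite mulr_ge0 // ltW.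
- rewrite /leftover_size -addnA -mulnDr subnKC ?reserve_size_le_block_size // addnC.
  by rewrite [X in (X <= _)%N](divn_eq n k) leq_add2l ltnW // ltn_pmod.
- by rewrite mulrA -natrM ltW // truncnS_gt.
- rewrite -{1}[n%:R]lnK // -expRD -[leRHS]expR0 ler_expR.
  by have := regime_ln_n_le reg; lra.
rewrite [leRHS]mulr_natl mulr2n lerD // ler_expR; last by lra.
rewrite (_ : (4 * (16 * n%:R)^-1)^-1 = 4 * n%:R); last by field; rewrite gt_eqF.
lra.
Qed.

End RegimeColoring.

(** * Lower bound *)

Section HeavySet.
Variables (R : realType) (n : nat) (q : 'I_n * 'I_n -> R).

Definition heavy (K : R) (S : {set 'I_n}) : bool :=
  K * #|S|%:R < \sum_(e in pairs_within S) q e.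

Hypothesis q01 : forall e, 0 <= q e <= 1.

Lemma prob_independent_le (S : {set 'I_n}) :
  subset_prob (vpairs n) q (fun G => independent G S) <=
  expR (- \sum_(e in pairs_within S) q e).
Proof.
have -> : subset_prob (vpairs n) q (fun G => independent G S) = absent_prob q (pairs_within S).
  exact: subset_mean_absent (pairs_within_sub S).
rewrite -sumrN expR_sum; apply: ler_prod => e _; rewrite subr_ge0 expR_ge1Dx andbT.
by have /andP[] := q01 e.
Qed.

Lemma prob_heavy_independent_le (p L d : R) :
  (forall e, q e <= 2 * p) -> 0 < p -> 1 <= d * L -> p * n%:R = expR L ->
  subset_prob (vpairs n) q
    (fun G => [exists S : {set 'I_n}, heavy ((1 + d) * L - 1) S && independent G S])
  <= expR ((4 - d * L ^+ 2) / p).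
Proof.
move=> qp p0 dL pn; apply: le_trans (subset_prob_exists_le _ q01 _ _) _.
set K := (1 + d) * L - 1; have dL0 : 0 <= d * L by lra.
apply: (@le_trans _ _ (\sum_(S : {set 'I_n} | L / p <= #|S|%:R) expR (- K) ^+ #|S|)); last first.
  apply: le_trans (sum_large_expr_card_le _ _ (expR_ge0 _) dL0) _.
  rewrite ler_expR card_ord -expRD mulrBl expr2 !mulrA lerD2r.
  rewrite ler_pdivlMr // -mulrA [n%:R * p]mulrC pn -expRD.
  rewrite (_ : _ + L = 1) ?expR1_le4 // /K; ring.
rewrite [leLHS]big_mkcond [leRHS]big_mkcond; apply: ler_sum => S _.
case: ifP => [heavyS|_]; last by case: ifP => // _; rewrite exprn_ge0 ?expR_ge0.
have S0 : 0 < #|S|%:R :> R.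
  rewrite ltr0n lt0n; apply: contraTneq heavyS => S0.
  rewrite /heavy S0 mulr0 (cards0_eq S0) big1 ?ltxx // => e.
  by rewrite !inE !andbF.
have -> : L / p <= #|S|%:R.
  rewrite ler_pdivrMr // -(ler_pM2r S0).
  have := sum_pairs_within_le qp (mulr_ge0 (ler0n R 2) (ltW p0)) S.
  have := heavyS; rewrite /heavy /K expr2.
  have := ler_wpM2r (ltW S0) dL; lra.
apply: le_trans (prob_independent_le S) _.
by rewrite -expRM_natr ler_expR mulNr lerN2 ltW.
Qed.

End HeavySet.

Section ChromaticLowerBound.
Variables (R : realFieldType) (n : nat) (u : 'I_n -> R) (K : R) (G : {set 'I_n * 'I_n}).
Hypothesis sG : G \subset vpairs n.

Lemma sum_weights_le_chi :
  (forall S : {set 'I_n}, independent G S -> \sum_(i in S) u i <= K) ->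
  \sum_i u i <= K * (chi G)%:R.
Proof.
move=> indep_le; have [f f_indep] := chi_color_classes sG.
rewrite (partition_big f xpredT) //= mulr_natr -[X in _ *+ X]card_ord -sumr_const.
apply: ler_sum => c _; have := indep_le _ (f_indep setT c).
by rewrite [X in X <= _ -> _](eq_bigl (fun i => f i == c)) // => i; rewrite !inE.
Qed.

Lemma max_density_le_chi : 0 <= K ->
  (forall S : {set 'I_n}, independent G S -> (\sum_(i in S) u i) ^+ 2 <= K * #|S|%:R) ->
  max_density u <= K * (chi G)%:R.
Proof.
move=> K0 indep_le; have [f f_indep] := chi_color_classes sG.
apply: max_density_le_bound => [|U]; first exact: mulr_ge0.
rewrite (partition_big f xpredT) //=; apply: le_trans (sqr_sum_le_card _) _.
rewrite card_ord mulrAC [leRHS]mulrC ler_wpM2l // (card_sum_fibers f) natr_sum mulr_sumr.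
apply: ler_sum => c _; have := indep_le _ (f_indep U c).
rewrite [X in X ^+ 2 <= _ -> _](eq_bigl (fun i => (i \in U) && (f i == c))) // => i.
by rewrite inE.
Qed.

End ChromaticLowerBound.

Section PairSums.
Variables (R : realFieldType) (n : nat) (u : 'I_n -> R) (p : R).
Hypothesis u01 : forall i, 0 <= u i <= 1.
Hypothesis p01 : 0 <= p <= 1.

Lemma sum_mul_pairs_ge (S : {set 'I_n}) :
  p * (\sum_(i in S) u i) ^+ 2 / 2 - #|S|%:R <= \sum_(e in pairs_within S) p * (u e.1 * u e.2).
Proof.
have /andP[p0 p1] := p01.
have := sum_pairs_within_diag (F := fun i j => p * (u i * u j)) S
  (fun i j => congr1 _ (mulrC _ _)).
have -> : \sum_(i in S) \sum_(j in S) p * (u i * u j) = p * (\sum_(i in S) u i) ^+ 2.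
  rewrite expr2 mulr_suml mulr_sumr; apply: eq_bigr => i _.
  by rewrite !mulr_sumr.
have : \sum_(i in S) p * (u i * u i) <= #|S|%:R.
  rewrite -sumr_const; apply: ler_sum => i _; have /andP[u0 u1] := u01 i.
  by rewrite !mulr_ile1 ?mulr_ge0.
have := ler0n R #|S|; lra.
Qed.

Lemma sum_add_pairs_ge (S : {set 'I_n}) :
  p * (\sum_(i in S) u i) * #|S|%:R - #|S|%:R <= \sum_(e in pairs_within S) p * (u e.1 + u e.2).
Proof.
have /andP[p0 p1] := p01.
have := sum_pairs_within_diag (F := fun i j => p * (u i + u j)) S
  (fun i j => congr1 _ (addrC _ _)).
have -> : \sum_(i in S) \sum_(j in S) p * (u i + u j) = 2 * (p * (\sum_(i in S) u i) * #|S|%:R).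
  under eq_bigr => i _ do rewrite -mulr_sumr big_split /= sumr_const.
  by rewrite -mulr_sumr big_split /= sumr_const sumrMnl; ring.
have -> : \sum_(i in S) p * (u i + u i) = 2 * (p * \sum_(i in S) u i).
  by rewrite !mulr_sumr; apply: eq_bigr => i _; ring.
have := sum_weights_ge0 u01 S; have := sum_weights_le_card u01 S => Scard S0.
have : p * \sum_(i in S) u i <= 1 * #|S|%:R by exact: ler_pM.
lra.
Qed.

End PairSums.

(** * Concentration for bounded monotone kernels *)

Record bounded_kernel (R : numDomainType) (h : R -> R -> R) : Prop := BoundedKernel {
  kernelC : forall x y, h x y = h y x;
  kernel_le : forall x x' y y', 0 <= x <= x' -> 0 <= y <= y' -> h x y <= h x' y';
  kernel00_ge0 : 0 <= h 0 0;
  kernel11_le2 : h 1 1 <= 2 }.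

Lemma bounded_kernel_mul (R : numDomainType) : bounded_kernel (fun x y : R => x * y).
Proof.
split=> [x y|x x' y y' /andP[x0 xx'] /andP[y0 yy']||]; first exact: mulrC.
- exact: ler_pM.
- by rewrite mul0r.
- by rewrite mul1r ler1n.
Qed.

Lemma bounded_kernel_add (R : numDomainType) : bounded_kernel (fun x y : R => x + y).
Proof.
split=> [x y|x x' y y' /andP[_ xx'] /andP[_ yy']||]; first exact: addrC.
- exact: lerD.
- by rewrite addr0.
- by [].
Qed.

Section KernelGraph.
Variables (R : realType) (n : nat) (u : 'I_n -> R) (h : R -> R -> R) (p c d Y : R).
Hypothesis u01 : forall i, 0 <= u i <= 1.
Hypothesis h_kernel : bounded_kernel h.
Hypothesis reg : dense_regime n p c d.
Local Notation L := (ln (p * n%:R)).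
Local Notation k := (block_size d Y).
Local Notation s := (n %/ block_size d Y)%N.
Local Notation w := (block_max u (weight_block u k)).

Definition kernel_prob (e : 'I_n * 'I_n) : R := p * h (u e.1) (u e.2).

(* The slack d / 16 turns the probability of a non-edge, bounded below by
   1 - p h, into an exponential. *)
Definition kernel_energy (t t' : nat) : R := (1 + d / 16) * (p * h (w t) (w t')).

Lemma kernel_between x y : 0 <= x <= 1 -> 0 <= y <= 1 -> 0 <= h x y <= 2.
Proof.
have [_ hle h0 h1] := h_kernel; move=> /andP[x0 x1] /andP[y0 y1].
by rewrite (le_trans h0) ?(le_trans _ h1) // hle ?lexx ?x0 ?y0.
Qed.

Lemma kernel_prob_between e : 0 <= kernel_prob e <= 2 * p.
Proof.
have [p0 _ _ _ _ _ _] := reg; have /andP[h0 h2] := kernel_between (u01 e.1) (u01 e.2).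
by rewrite /kernel_prob mulr_ge0 ?(ltW p0) //= mulrC ler_pM2r.
Qed.

Lemma kernel_prob01 e : 0 <= kernel_prob e <= 1.
Proof.
have [p0 pd _ /andP[_ d1] _ _ _] := reg; have /andP[-> q2] := kernel_prob_between e.
by rewrite /=; lra.
Qed.

Lemma kernel_energy_sym t t' : kernel_energy t t' = kernel_energy t' t.
Proof. by rewrite /kernel_energy (kernelC h_kernel). Qed.

Lemma kernel_energy_between t t' : 0 <= kernel_energy t t' <= 4 * p.
Proof.
have [p0 _ _ /andP[d0 d1] _ _ _] := reg.
have w01 t0 := block_max01 (weight_block u k) u01 t0.
have /andP[h0 h2] := kernel_between (w01 t) (w01 t').
have ph0 : 0 <= p * h (w t) (w t') by rewrite mulr_ge0 // ltW.
have ph2 := ler_wpM2l (ltW p0) h2.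
apply/andP; split; first by rewrite mulr_ge0 //; lra.
rewrite (_ : 4 * p = 2 * (p * 2)); last by ring.
by apply: ler_pM => //; lra.
Qed.

Lemma kernel_prob_le_energy (e : 'I_n * 'I_n) :
  expR (- kernel_energy (weight_block u k e.1) (weight_block u k e.2)) <= 1 - kernel_prob e.
Proof.
have [p0 pd _ /andP[d0 d1] _ _ _] := reg.
have /andP[q0 q2] := kernel_prob_between e.
have /andP[u1 _] := u01 e.1; have /andP[u2 _] := u01 e.2.
apply: expR_opp_le_1B; first by lra.
  by rewrite q0 ler_pM2l // (kernel_le h_kernel) ?u1 ?u2 ?le_block_max.
have : (1 + d / 16) * kernel_prob e <= 2 * (2 * p) by apply: ler_pM => //; lra.
lra.
Qed.

Lemma kernel_energy_le_sqr (I : {set 'I_s}) : pair_energy kernel_energy I <= 2 * p * #|I|%:R ^+ 2.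
Proof.
by apply: le_trans (pair_energy_le_sqr I kernel_energy_between) _; lra.
Qed.

Lemma kernel_concentration (delta eta : R) :
  d <= delta -> 0 < eta -> 3 / eta <= L ->
  c * (p * n%:R) <= Y * L -> Y * L <= p * n%:R ->
  (forall I : {set 'I_s}, (0 < #|I|)%N ->
     pair_energy kernel_energy I <= (1 - d / 16) * L * #|I|%:R) ->
  (forall G : {set 'I_n * 'I_n}, G \subset vpairs n ->
     (forall S, independent G S ->
        \sum_(e in pairs_within S) kernel_prob e <= ((1 + d) * L - 1) * #|S|%:R) ->
     Y <= (1 + d) * (chi G)%:R) ->
  1 - eta <= subset_prob (vpairs n) kernel_prob
    (fun G => (1 - delta) * Y <= (chi G)%:R <= (1 + delta) * Y).
Proof.
move=> d_delta eta0 eta_L Y_ge Y_le energy_le lower.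
have [p0 _ _ /andP[d0 d1] _ _ _] := reg; have L64 := regime_L_ge reg; have dL := regime_dL_ge reg.
have Y0 := regime_Y_gt0 reg Y_ge.
have error_le : 2 * expR (- L) + expR (- L) <= eta.
  suff : 3 * expR (- L) <= eta by lra.
  rewrite expRN ler_pdivrMr ?expR_gt0 //; rewrite ler_pdivrMr // in eta_L.
  have := ler_wpM2r (ltW eta0) (expR_ge1Dx L); lra.
apply: (@le_trans _ _ (1 - (2 * expR (- L) + expR (- L)))); first by rewrite lerD2l lerN2.
apply: (subset_prob_ge_compl kernel_prob01 (B := fun G => (1 + d) * Y < (chi G)%:R)
  (C := fun G => [exists S, heavy kernel_prob ((1 + d) * L - 1) S && independent G S])).
- move=> G sG; rewrite -leNgt => upper /existsPn no_heavy.
  have {}lower : Y <= (1 + d) * (chi G)%:R.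
    by apply: lower => // S indep; have := no_heavy S; rewrite indep andbT -leNgt.
  have dY : d * Y <= delta * Y by rewrite ler_pM2r.
  apply/andP; split; last by lra.
  have d1_ge0 : 0 <= 1 - d by lra.
  have := ler_wpM2l d1_ge0 lower.
  have : 0 <= d * d * (chi G)%:R by rewrite !mulr_ge0 // ltW.
  lra.
- apply: (regime_prob_chi_gt_le reg Y_ge Y_le kernel_prob01 _ kernel_energy_sym
    kernel_prob_le_energy) => //.
  + by move=> e; have /andP[] := kernel_prob_between e.
  + by move=> t; exact: card_weight_block.
  + exact: kernel_energy_le_sqr.
- apply: le_trans (regime_first_moment_le reg); apply: prob_heavy_independent_le => //.
  + exact: kernel_prob01.
  + by move=> e; have /andP[] := kernel_prob_between e.
  + by lra.
  + by rewrite (regime_expR_ln reg).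
Qed.

End KernelGraph.

Lemma model_timesE (R : realType) (n : nat) (u : 'I_n -> R) (p : R) A :
  model_times u p A = subset_prob (vpairs n) (kernel_prob u *%R p) A.
Proof.
rewrite /model_times graph_probE; congr subset_prob; apply/funext => e.
by rewrite /kernel_prob mulrA.
Qed.

Lemma model_plusE (R : realType) (n : nat) (u : 'I_n -> R) (p : R) A :
  model_plus u p A = subset_prob (vpairs n) (kernel_prob u +%R p) A.
Proof. by rewrite /model_plus graph_probE. Qed.

Section Concentration.
Variables (R : realType) (n : nat) (u : 'I_n -> R) (p c d delta eta : R).
Hypothesis u01 : forall i, 0 <= u i <= 1.
Hypothesis c01 : 0 < c <= 1.
Hypothesis u_ge : c * n%:R <= \sum_i u i.
Hypothesis reg : dense_regime n p (c ^+ 2 / 2) d.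
Local Notation L := (ln (p * n%:R)).
Hypothesis d_delta : d <= delta.
Hypothesis eta_gt0 : 0 < eta.
Hypothesis eta_L : 3 / eta <= L.

Lemma max_density_ge_sqr : c ^+ 2 * n%:R <= max_density u.
Proof.
have /andP[c0 _] := c01; have n0 := regime_n_gt0 reg.
have := sqr_sum_le_max_density u [set: 'I_n]; rewrite cardsT card_ord.
rewrite (eq_bigl xpredT) => [density_ge|i]; last exact: in_setT.
rewrite -(ler_pM2r n0); apply: le_trans density_ge.
by rewrite -mulrA -expr2 -exprMn lerXn2r ?nnegrE ?(le_trans _ u_ge) ?mulr_ge0 ?(ltW c0).
Qed.

Lemma model_times_concentration (Y : R) : Y = p / (2 * L) * max_density u ->
  1 - eta <= model_times u p (fun G => (1 - delta) * Y <= (chi G)%:R <= (1 + delta) * Y).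
Proof.
move=> YE; have [p0 pd _ d01 _ _ _] := reg; have L64 := regime_L_ge reg.
have dL := regime_dL_ge reg; have p01 := regime_p01 reg.
have L0 : 0 < L by lra.
have p_le : 16 * p <= d by lra.
have dL_ge : 32 <= d * L by lra.
have YL : Y * L = p * max_density u / 2 by rewrite YE; field; rewrite gt_eqF.
rewrite model_timesE.
apply: (kernel_concentration u01 (@bounded_kernel_mul R) reg d_delta eta_gt0 eta_L).
- rewrite YL; have := ler_wpM2l (ltW p0) max_density_ge_sqr; lra.
- rewrite YL; have := ler_wpM2l (ltW p0) (max_density_le u01).
  have : 0 <= p * n%:R by rewrite mulr_ge0 // ltW.
  lra.
- move=> I I0; apply: (mul_kernel_energy_le (k := block_size d Y) u01 (@weight_block_anti _ _ u _)
    _ _ (ltW p0)) => //.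
  + by move=> t; exact: card_weight_block.
  + rewrite (_ : p * max_density u = 2 * (Y * L)); last by lra.
    by have := ler_wpM2r (ltW L0) (block_size_ge d Y); lra.
- move=> G sG light; rewrite -(ler_pM2r L0) YL.
  have /andP[d0 _] := d01.
  have K0 : 0 <= 2 * (1 + d) * L / p by rewrite divr_ge0 ?mulr_ge0 ?addr_ge0 // ltW.
  have := max_density_le_chi (u := u) sG K0; set b := _ * (chi G)%:R => density_le.
  have {}density_le : max_density u <= b.
    apply: density_le => S /light pairs_le; have pairs_ge := sum_mul_pairs_ge u01 p01 S.
    by rewrite [leRHS]mulrAC ler_pdivlMr //; have := le_trans pairs_ge pairs_le; lra.
  have := ler_wpM2l (ltW p0) density_le.
  rewrite /b (_ : p * (_ * (chi G)%:R) = 2 * (1 + d) * L * (chi G)%:R); first by lra.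
  by field; rewrite gt_eqF.
Qed.

Lemma model_plus_concentration (Y : R) : Y = p / L * \sum_i u i ->
  1 - eta <= model_plus u p (fun G => (1 - delta) * Y <= (chi G)%:R <= (1 + delta) * Y).
Proof.
move=> YE; have [p0 pd _ d01 _ _ _] := reg; have L64 := regime_L_ge reg.
have dL := regime_dL_ge reg; have p01 := regime_p01 reg.
have /andP[c0 c1] := c01; have /andP[d0 _] := d01.
have L0 : 0 < L by lra.
have p_le : 16 * p <= d by lra.
have dL_ge : 32 <= d * L by lra.
have pn0 : 0 <= p * n%:R by rewrite mulr_ge0 // ltW.
have YL : Y * L = p * \sum_i u i by rewrite YE; field; rewrite gt_eqF.
rewrite model_plusE.
apply: (kernel_concentration u01 (@bounded_kernel_add R) reg d_delta eta_gt0 eta_L).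
- rewrite YL; apply: le_trans (ler_wpM2l (ltW p0) u_ge).
  have := ler_wpM2r pn0 (ler_wpM2l (ltW c0) c1); have := mulr_ge0 (ltW c0) pn0.
  rewrite expr2; lra.
- rewrite YL ler_pM2l //; have := sum_weights_le_card u01 [set: 'I_n]; rewrite cardsT card_ord.
  by rewrite (eq_bigl xpredT) // => i; exact: in_setT.
- move=> I _; apply: (add_kernel_energy_le (k := block_size d Y) u01 (@weight_block_anti _ _ u _)
    _ _ (ltW p0)) => //.
  + by move=> t; exact: card_weight_block.
  + by rewrite -YL; have := ler_wpM2r (ltW L0) (block_size_ge d Y); lra.
- move=> G sG light; rewrite -(ler_pM2r L0) YL.
  have sum_le S : independent G S -> \sum_(i in S) u i <= (1 + d) * L / p.
    move=> /light; have := sum_add_pairs_ge u01 p01 S.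
    have [->|S0] := set_0Vmem S.
      by rewrite big_set0 => _ _; rewrite divr_ge0 ?mulr_ge0 ?addr_ge0 // ltW.
    move=> pairs_ge pairs_le; rewrite ler_pdivlMr //.
    have S_gt0 : 0 < #|S|%:R :> R by rewrite ltr0n; apply/card_gt0P; have [i] := S0; exists i.
    by rewrite -(ler_pM2r S_gt0); lra.
  have := ler_wpM2l (ltW p0) (sum_weights_le_chi sG sum_le).
  rewrite (_ : p * (_ * (chi G)%:R) = (1 + d) * L * (chi G)%:R); first by lra.
  by field; rewrite gt_eqF.
Qed.

End Concentration.

(** * Asymptotics *)

Local Open Scope classical_set_scope.
Local Open Scope ring_scope.

Lemma near_monomial_le_expR (R : realType) (k : nat) (a K : R) : 0 < a ->
  \forall x \near +oo, K * x ^+ k <= expR (a * x).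
Proof.
move=> a0; near=> x.
have x0 : 0 < x by near: x; exact: nbhs_pinfty_gt.
have ak_gt0 : 0 < a ^+ k.+1 by exact: exprn_gt0.
have fact0 : 0 < k.+1`!%:R :> R by rewrite ltr0n fact_gt0.
suff monomial_le : K * x ^+ k <= (a * x) ^+ k.+1 / k.+1`!%:R.
  by apply: le_trans (expR_ge1Dxn k (ltW (mulr_gt0 a0 x0))); rewrite ler_wpDl.
rewrite ler_pdivlMr // exprMn [x ^+ k.+1]exprS mulrA [leLHS]mulrAC.
rewrite ler_wpM2r ?exprn_ge0 ?(ltW x0) // -ler_pdivrMl //; near: x; exact: nbhs_pinfty_ge.
Unshelve. all: by end_near. Qed.

Lemma cvgy_ln (R : realType) : @ln R x @[x --> +oo] --> +oo.
Proof.
apply/cvgryPge => A; near=> x.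
by rewrite -[A]expRK ler_ln ?posrE ?expR_gt0 //; near: x; exact: nbhs_pinfty_ge.
Unshelve. all: by end_near. Qed.

Section DenseSequence.
Variables (R : realType) (eps : R) (p : nat -> R).
Hypothesis eps_gt0 : 0 < eps.
Hypothesis p_small : p @ \oo --> (0 : R).
Hypothesis p_large : \forall n \near \oo, n%:R `^ (- (1 / 4) + eps) <= p n.

Lemma cvgy_ln_nat : ln (n%:R : R) @[n --> \oo] --> +oo.
Proof. exact: cvg_comp cvgr_idn (@cvgy_ln R). Qed.

Lemma near_ln_mul_between :
  \forall n \near \oo, 3 / 4 * ln n%:R <= ln (p n * n%:R) <= ln n%:R.
Proof.
near=> n.
have n1 : 1 <= n%:R :> R by rewrite ler1n; near: n; exact: nbhs_infty_gt.
have n0 : 0 < n%:R :> R by lra.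
have pn_ge : n%:R `^ (- (1 / 4) + eps) <= p n by near: n.
have p0 : 0 < p n by apply: lt_le_trans pn_ge; exact: powR_gt0.
have p1 : p n < 1.
  apply: le_lt_trans (ler_norm _) _; near: n; exact: cvgr0_norm_lt p_small _ ltr01.
apply/andP; split; last by rewrite ler_ln ?posrE ?mulr_gt0 // ler_piMl ?ltW.
have ln_p_ge : (- (1 / 4) + eps) * ln n%:R <= ln (p n).
  by rewrite -ln_powR ler_ln ?posrE ?powR_gt0.
rewrite lnM ?posrE //; have := mulr_ge0 (ltW eps_gt0) (ln_ge0 n1); lra.
Unshelve. all: by end_near. Qed.

Lemma cvgy_ln_mul : ln (p n * n%:R) @[n --> \oo] --> +oo.
Proof.
apply/cvgryPge => A; near=> n.
have /andP[ln_ge _] : 3 / 4 * ln n%:R <= ln (p n * n%:R) <= ln n%:R.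
  by near: n; exact: near_ln_mul_between.
apply: le_trans ln_ge; rewrite mulrC -ler_pdivrMr //.
near: n; exact: cvgry_ge cvgy_ln_nat _.
Unshelve. all: by end_near. Qed.

Lemma near_regime_sqrt_ge (c : R) : 0 < c ->
  \forall n \near \oo, expR 5 * ln (p n * n%:R) ^+ 4 <= c ^+ 2 * p n ^+ 2 * Num.sqrt n%:R.
Proof.
move=> c0; have eps2_gt0 : 0 < 2 * eps by exact: mulr_gt0.
near=> n.
have n1 : 1 <= n%:R :> R by rewrite ler1n; near: n; exact: nbhs_infty_gt.
have n0 : 0 < n%:R :> R by lra.
have /andP[ln_ge ln_le] : 3 / 4 * ln n%:R <= ln (p n * n%:R) <= ln n%:R.
  by near: n; exact: near_ln_mul_between.
have pn_ge : n%:R `^ (- (1 / 4) + eps) <= p n by near: n.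
have p2_ge : expR (2 * eps * ln n%:R) <= p n ^+ 2 * Num.sqrt n%:R.
  apply: (@le_trans _ _ ((n%:R `^ (- (1 / 4) + eps)) ^+ 2 * Num.sqrt n%:R)).
    rewrite -(powR12_sqrt (ltW n0)) -powR_mulrn ?powR_ge0 // -powRrM.
    by rewrite -powRD ?(gt_eqF n0) ?implybT // /powR (gt_eqF n0) ler_expR; lra.
  by rewrite ler_wpM2r ?sqrtr_ge0 // lerXn2r ?nnegrE ?powR_ge0 ?(le_trans _ pn_ge) ?powR_ge0.
have ln4_le : expR 5 / c ^+ 2 * ln n%:R ^+ 4 <= expR (2 * eps * ln n%:R).
  by near: n; exact: (cvgy_ln_nat (near_monomial_le_expR 4 _ eps2_gt0)).
have ln_n0 := ln_ge0 n1.
rewrite -mulrA -ler_pdivrMl ?exprn_gt0 //; apply: le_trans p2_ge; apply: le_trans ln4_le.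
rewrite mulrA [_^-1 * _]mulrC ler_wpM2l ?divr_ge0 ?expR_ge0 ?sqr_ge0 //.
by rewrite lerXn2r ?nnegrE // (le_trans _ ln_ge) // mulr_ge0.
Unshelve. all: by end_near. Qed.

Lemma near_dense_regime (c d : R) : 0 < c <= 1 -> 0 < d <= 1 ->
  \forall n \near \oo, dense_regime n (p n) c d.
Proof.
move=> c01 d01; have /andP[c0 _] := c01; have /andP[d0 _] := d01.
have d32_gt0 : 0 < d / 32 by exact: divr_gt0.
have d256_gt0 : 0 < d / 256 by exact: divr_gt0.
near=> n.
have n0 : 0 < n%:R :> R by rewrite ltr0n; near: n; exact: nbhs_infty_gt.
split => //.
- apply: lt_le_trans (_ : n%:R `^ (- (1 / 4) + eps) <= p n); first exact: powR_gt0.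
  by near: n.
- rewrite mulrC -ler_pdivlMr //; apply: le_trans (ler_norm _) _; apply: ltW.
  by near: n; exact: cvgr0_norm_lt p_small _ d256_gt0.
- rewrite mulrC -ler_pdivrMr ?mulr_gt0 //; near: n; exact: cvgry_ge cvgy_ln_mul _.
- by near: n; exact: near_regime_sqrt_ge.
- rewrite -ler_pdivrMl ?exprn_gt0 //.
  by near: n; exact: (cvgy_ln_mul (near_monomial_le_expR 4 _ d32_gt0)).
Unshelve. all: by end_near. Qed.

End DenseSequence.

Theorem theorem1p4 (R : realType) (eps : R) (eps_gt0 : 0 < eps)
    (p : nat -> R) (p_small : p @ \oo --> (0 : R))
    (p_large : \forall n \near \oo, n%:R `^ (- (1 / 4) + eps) <= p n) :
  forall c delta eta : R, 0 < c -> 0 < delta -> 0 < eta ->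
  \forall n \near \oo, forall u : 'I_n -> R,
    (forall i, 0 <= u i <= 1) -> c * n%:R <= \sum_(i < n) u i ->
    (let Y := p n / (2 * ln (p n * n%:R)) * max_density u in
     1 - eta <= model_times u (p n)
       (fun G => (1 - delta) * Y <= (chi G)%:R <= (1 + delta) * Y)) /\
    (let Y := p n / ln (p n * n%:R) * \sum_(i < n) u i in
     1 - eta <= model_plus u (p n)
       (fun G => (1 - delta) * Y <= (chi G)%:R <= (1 + delta) * Y)).
Proof.
move=> c delta eta c0 delta0 eta0.
pose c1 := Num.min c 1; pose d := Num.min delta 1.
have c1_01 : 0 < c1 <= 1 by rewrite lt_min c0 ltr01 ge_min lexx orbT.
have d01 : 0 < d <= 1 by rewrite lt_min delta0 ltr01 ge_min lexx orbT.
have c1sq01 : 0 < c1 ^+ 2 / 2 <= 1.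
  have /andP[c1_gt0 c1_le1] := c1_01.
  by rewrite divr_gt0 ?exprn_gt0 //=; have := exprn_ile1 2 (ltW c1_gt0) c1_le1; lra.
near=> n => u u01 cu.
have reg : dense_regime n (p n) (c1 ^+ 2 / 2) d.
  by near: n; exact: (near_dense_regime eps_gt0 p_small p_large c1sq01 d01).
have eta_le : 3 / eta <= ln (p n * n%:R).
  by near: n; exact: cvgry_ge (cvgy_ln_mul eps_gt0 p_small p_large) _.
have c1u : c1 * n%:R <= \sum_i u i.
  by apply: le_trans cu; rewrite ler_wpM2r // ge_min lexx.
have d_delta : d <= delta by rewrite ge_min lexx.
split.
- exact: (model_times_concentration u01 c1_01 c1u reg d_delta eta0 eta_le erefl).
- exact: (model_plus_concentration u01 c1_01 c1u reg d_delta eta0 eta_le erefl).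
Unshelve. all: by end_near. Qed.
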